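(* Let $X_t=x+pt-\sum_{i=1}^{N_t}S_i$, $t\ge0$, be the (unperturbed) Cramér-Lundberg process with exponentially distributed claims of parameter $\gamma>0$ described in the context. Then for all $x\ge0$ $$\mathbb{E}_x[\tau_0^-\mid\tau_0^-<\infty]=\begin{cases}\dfrac{\gamma x+1}{\lambda-p\gamma},&\text{if }\psi'(0+)=p-\frac\lambda\gamma<0,\\[2mm]\dfrac{\frac{\lambda}{p}x+1}{p\gamma-\lambda},&\text{if }\psi'(0+)=p-\frac\lambda\gamma>0,\end{cases}$$ while whenever $\psi'(0+)\ne0$ $$\operatorname{Var}_x(\tau_0^-\mid\tau_0^-<\infty)=\frac{2\lambda\gamma x}{|p\gamma-\lambda|^3}+\frac{p\gamma+\lambda}{|p\gamma-\lambda|^3},\qquad x\ge0.$$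
   Context: Here $x\ge0$ is the initial capital, $p>0$ the premium rate, $(N_t)$ a Poisson process with intensity $\lambda$ (with $\lambda>0$, since $X$ is assumed not to be a pure drift), and the claims $S_i$ are i.i.d. exponential with parameter $\gamma>0$ (mean $1/\gamma$), independent of $(N_t)$. $\mathbb{E}_x$ is the expectation given $X_0=x$, $\operatorname{Var}_x(\cdot\mid\tau_0^-<\infty)$ the corresponding conditional variance, and $\tau_0^-:=\inf\{t\ge0:X_t<0\}$ is the ruin time. The Laplace exponent $\psi(\theta)=\frac1t\log\mathbb{E}_0[e^{\theta X_t}]$ is $\psi(\theta)=p\theta-\frac{\theta\lambda}{\theta+\gamma}$. *)

(* Defs.v *)
From HB Require Import structures.
From mathcomp Require Import all_boot all_order all_algebra.
From mathcomp Require Import all_classical all_reals all_analysis.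

Set Implicit Arguments.
Unset Strict Implicit.
Unset Printing Implicit Defensive.

Import Order.TTheory GRing.Theory Num.Theory.
Import numFieldNormedType.Exports.

Local Open Scope classical_set_scope.
Local Open Scope ring_scope.

Section Independence.
Context (d : measure_display) (T : measurableType d) (R : realType).
Variable P : probability T R.

(* Product rule over every finite subfamily: [J] lists the distinct indices. *)
Definition mutually_independent (d' : measure_display) (T' : measurableType d')
    (I : choiceType) (Y : I -> T -> T') : Prop :=
  forall (J : seq I) (A : I -> set T'), uniq J ->
    (forall i, measurable (A i)) ->
    P (\bigcap_(i in [set` J]) Y i @^-1` A i) =
    (\prod_(i <- J) P (Y i @^-1` A i))%E.

Definition sigma_generated (d' : measure_display) (T' : measurableType d')
    (I : Type) (D : set I) (Y : I -> T -> T') : set (set T) :=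
  <<s \bigcup_(i in D) preimage_set_system setT (Y i) measurable >>.

Definition independent_sigma (F G : set (set T)) : Prop :=
  forall A B, F A -> G B -> P (A `&` B) = (P A * P B)%E.

End Independence.

Section Processes.
Context (d : measure_display) (T : measurableType d) (R : realType).
Variable P : probability T R.

(* Only the times [t >= 0] are constrained. The truncated subtraction of [nat]
   is a genuine increment because the paths are nondecreasing. Intervals of
   length zero are left out of the law of the increments since [poisson_pmf]
   is only meaningful for a positive rate. *)
Record is_poisson_process (lambda : R) (N : R -> {RV P >-> nat}) : Prop := {
  poisson_process0 : forall w, N 0 w = 0%N ;
  poisson_process_nondecreasing : forall w (s t : R),
    0 <= s -> s <= t -> (N s w <= N t w)%N ;
  poisson_process_right_continuous : forall w (t : R), 0 <= t ->
    (fun s => N s w) @ t^'+ --> N t w ;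
  poisson_process_independent_increments : forall t : nat -> R,
    0 <= t 0%N -> {homo t : i j / (i <= j)%N >-> i <= j} ->
    mutually_independent P (fun i w => (N (t i.+1) w - N (t i) w)%N) ;
  poisson_process_law : forall (s t : R) (k : nat), 0 <= s -> s < t ->
    P [set w | (N t w - N s w)%N = k] = (poisson_pmf (lambda * (t - s)) k)%:E
}.

(* The claim [S_i] of the text, [i >= 1], is [S i.-1]. *)
Definition cramer_lundberg (x p : R) (N : R -> {RV P >-> nat})
    (S : nat -> {RV P >-> R}) (t : R) (w : T) : R :=
  x + p * t - \sum_(i < N t w) S i w.

(* Equal to [+oo] on the paths that never become negative. *)
Definition ruin_time (X : R -> T -> R) (w : T) : \bar R :=
  ereal_inf [set t%:E | t in [set t : R | 0 <= t /\ X t w < 0]].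

Definition laplace_exponent (X : R -> T -> R) (t theta : R) : R :=
  t^-1 * ln (fine ('M_P (X t) theta)).

(* Elementary conditioning on an event; the integrals range over [A] only, so
   the values of [Y] outside [A], possibly infinite, are irrelevant. *)
Definition cond_expectation (A : set T) (Y : T -> \bar R) : \bar R :=
  ((\int[P]_(w in A) Y w) / P A)%E.

Definition cond_variance (A : set T) (Y : T -> \bar R) : \bar R :=
  cond_expectation A (fun w => (Y w - cond_expectation A Y) ^+ 2)%E.

End Processes.

(* Main.v *)
(* Fix r in (0, gamma), put c = gamma / (gamma - r) and q = lambda (c - 1) - p r,
   and let F be exp(-r y) for y >= 0 and c for y < 0. By lack of memory
   E F(y - S_1) = c exp(-r y) for every y >= 0, so that exp(-q t) F(X_t), stopped
   at ruin, is a martingale. On a grid of mesh h this holds up to an error O(h^2)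
   per step, and only needs the independence of one increment of N and of the next
   claim from the past. As the paths are right-continuous, the first grid time at
   which X is negative tends to tau when h tends to 0, whence
     E_x[exp(-q tau); tau < oo] = (1 - r / gamma) exp(-r x).
   The first two moments come out of the expansion of this identity at q = 0+,
   where r tends to 0 if lambda > p gamma and to gamma - lambda / p otherwise. *)

Require Import Defs.
From HB Require Import structures.
From mathcomp Require Import all_boot all_order all_algebra.
From mathcomp Require Import all_classical all_reals all_analysis.
From mathcomp Require Import measurable_realfun ring lra.

Set Implicit Arguments.
Unset Strict Implicit.
Unset Printing Implicit Defensive.

Import Order.TTheory GRing.Theory Num.Theory.
Import numFieldNormedType.Exports.

Local Open Scope classical_set_scope.
Local Open Scope ring_scope.

(** * Independence on the time grid *)

Section probability_generalities.
Context (d : measure_display) (T : measurableType d) (R : realType).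
Variable P : probability T R.
Local Open Scope ereal_scope.

(** The grid replaces continuous-time stopping and the strong Markov property by product formulas
    over finitely many coordinates. The delicate point is that the next claim has a random index,
    the current count; this index is frozen by splitting along the values of the count, which is why
    the history is indexed separately by steps and by claims.

    The rate q is tuned to [c]: with u = lambda h, the part of a step with at most one claim
    multiplies the mean of F by exp(-u) exp(-r p h) (1 + c u), and the discount exp(-q h) turns this
    into exp(-c u) (1 + c u), which is 1 up to (c u)^2. Two claims or more have probability at most
    u^2 and F is at most c, so a crude bound suffices there.

    Neither measurability nor integrability of tau is given. The former comes from the convergence
    of the grid transforms, tau being an infimum over uncountably many times; the latter from
    difference quotients that approach tau and tau^2 from below. Writing r = R0 + rho, with R0 the
    limit of r, makes q equal to rho (D + p rho) / (g - rho) in both regimes, so that one expansion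
    in rho serves both. *)

Lemma probability_countable_split (N : {RV P >-> nat}) (E : set T) :
  measurable E -> P E = \sum_(k <oo) P (E `&` N @^-1` [set k]).
Proof.
move=> mE.
rewrite -measure_semi_bigcup//=; first last.
- apply: bigcup_measurable => k _; apply: measurableI => //.
  by rewrite -[_ @^-1` _]setTI; exact: measurable_funP.
- apply/trivIsetP => i j _ _ ij; rewrite setIACA setIid -preimage_setI.
  rewrite (_ : _ `&` [set j] = set0) ?preimage_set0 ?setI0//.
  by apply/seteqP; split => // k [-> /eqP]; rewrite (negbTE ij).
- move=> k; apply: measurableI => //.
  by rewrite -[_ @^-1` _]setTI; exact: measurable_funP.
rewrite -setI_bigcupr -preimage_bigcup (_ : \bigcup_n [set n] = setT) ?preimage_setT ?setIT//.
by apply/seteqP; split => // n _; exists n.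
Qed.

(** Agreement on rectangles identifies the joint law with the product of the marginals, and Tonelli
    integrates [W] out first. With [Z] frozen, this plays the role of a conditional expectation
    given [Z]. *)
Lemma indep_integral (d1 d2 : measure_display) (T1 : measurableType d1)
    (T2 : measurableType d2) (Z : {RV P >-> T1}) (W : {RV P >-> T2})
    (f : T1 * T2 -> \bar R) :
  measurable_fun [set: (T1 * T2)%type] f -> (forall z, 0 <= f z) ->
  (forall A B, measurable A -> measurable B ->
    P (Z @^-1` A `&` W @^-1` B) = P (Z @^-1` A) * P (W @^-1` B)) ->
  \int[P]_w f (Z w, W w) =
  \int[P]_w \int[distribution P W]_s f (Z w, s).
Proof.
move=> mf f0 ZW.
have mZW : measurable_fun setT (fun w => (Z w, W w)).
  exact/measurable_fun_pairP.
pose ZW' : {RV P >-> (T1 * T2)%type} := mfun_Sub (mem_set mZW).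
transitivity (\int[distribution P ZW']_z f z).
  by rewrite ge0_integral_distribution.
transitivity (\int[distribution P Z \x distribution P W]_z f z).
  apply: eq_measure_integral => A mA _; symmetry.
  exact: product_measure_unique.
rewrite fubini_tonelli1//.
rewrite (@ge0_integral_distribution _ _ _ _ _ P Z (fubini_F (distribution P W) f))//.
  exact: measurable_fun_fubini_tonelli_F.
by move=> y; apply: integral_ge0.
Qed.

End probability_generalities.

(** * History of the grid, and independence of the step and the claim that follow it *)

Section cylinders.
Context (d : measure_display) (T : measurableType d) (R : realType).
Variable P : probability T R.
Variables (lambda : R) (N : R -> {RV P >-> nat}) (S : nat -> {RV P >-> R}).
Hypothesis N_poisson : is_poisson_process lambda N.
Hypothesis S_law : forall (i j : nat) (A : set R), measurable A ->
  distribution P (S i) A = distribution P (S j) A.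
Hypothesis S_indep : mutually_independent P (fun (i : nat) (w : T) => S i w).
Hypothesis NS_indep : independent_sigma P
  (sigma_generated [set s : R | 0 <= s] (fun (s : R) (w : T) => N s w))
  (sigma_generated [set: nat] (fun (i : nat) (w : T) => S i w)).
Variable h : R.
Hypothesis h_gt0 : 0 < h.

Definition incr (i : nat) (w : T) : nat :=
  (N (h * i.+1%:R) w - N (h * i%:R) w)%N.

Lemma grid_ge0 (i : nat) : 0 <= h * i%:R.
Proof. by rewrite mulr_ge0// ltW. Qed.
Local Hint Resolve grid_ge0 : core.

Lemma grid_homo : {homo (fun i : nat => h * i%:R) : i j / (i <= j)%N >-> i <= j}.
Proof. by move=> i j ij; rewrite ler_pM2l// ler_nat. Qed.

Lemma sum_incr (n : nat) (w : T) :
  (\sum_(i < n) incr i w)%N = N (h * n%:R) w.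
Proof.
elim: n => [|n IH]; first by rewrite big_ord0 mulr0 (poisson_process0 N_poisson).
rewrite big_ord_recr/= IH subnKC//.
by apply: (poisson_process_nondecreasing N_poisson) => //; exact: grid_homo.
Qed.

Lemma measurable_incr (i : nat) : measurable_fun setT (incr i).
Proof. by apply: measurable_fun_subn. Qed.

Definition cylinder (n k : nat) (M : nat -> set nat) (B : nat -> set R) : set T :=
  [set w | (forall i, (i < n)%N -> M i (incr i w)) /\
           (forall i, (i < k)%N -> B i (S i w))].

Let prob_cylinder_incr (n : nat) (M : nat -> set nat) :
  P [set w | forall i, (i < n)%N -> M i (incr i w)] =
  (\prod_(0 <= i < n) P (incr i @^-1` M i))%E.
Proof.
have := poisson_process_independent_increments N_poisson (grid_ge0 0) grid_homo.
move=> /(_ (iota 0 n) M (iota_uniq _ _) (fun=> I)); rewrite /index_iota subn0 => <-.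
congr (P _); apply/seteqP; split => w /= H i.
  by rewrite /= mem_iota/= add0n => /H.
by move=> ni; apply: H; rewrite /= mem_iota.
Qed.

Let prob_cylinder_claims (k : nat) (B : nat -> set R) :
  (forall i, measurable (B i)) ->
  P [set w | forall i, (i < k)%N -> B i (S i w)] =
  (\prod_(0 <= i < k) P (S i @^-1` B i))%E.
Proof.
move=> mB; rewrite /index_iota subn0 -(S_indep (iota_uniq _ _) mB).
congr (P _); apply/seteqP; split => w /= H i.
  by rewrite /= mem_iota/= add0n => /H.
by move=> ni; apply: H; rewrite /= mem_iota.
Qed.

Lemma prob_cylinder (n k : nat) (M : nat -> set nat) (B : nat -> set R) :
  (forall i, measurable (B i)) ->
  P (cylinder n k M B) = (\prod_(0 <= i < n) P (incr i @^-1` M i) *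
                          \prod_(0 <= i < k) P (S i @^-1` B i))%E.
Proof.
move=> mB; rewrite -prob_cylinder_incr -prob_cylinder_claims//.
rewrite -NS_indep//.
- pose G := \bigcup_(s in [set s : R | 0 <= s])
    preimage_set_system setT (fun w : T => N s w) measurable.
  have mN s : 0 <= s ->
      measurable_fun [set: g_sigma_algebraType G] (fun w : g_sigma_algebraType G => N s w).
    move=> s0 _ A mA; apply: sub_sigma_algebra; exists s => //.
    by exists A.
  have mI i : measurable_fun [set: g_sigma_algebraType G]
      (fun w : g_sigma_algebraType G => incr i w).
    by apply: measurable_fun_subn; apply: mN.
  rewrite /sigma_generated -/G.
  suff : measurable (\bigcap_(i < n) ((fun w : g_sigma_algebraType G => incr i w) @^-1` M i)).
    by congr (measurable _).
  apply: bigcap_measurableType => i _.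
  rewrite -[_ @^-1` _]setTI; exact: mI.
- pose G := \bigcup_(i in [set: nat])
    preimage_set_system setT (fun w : T => S i w) measurable.
  rewrite /sigma_generated -/G.
  suff : measurable (\bigcap_(i < k) ((fun w : g_sigma_algebraType G => S i w) @^-1` B i)).
    by [].
  apply: bigcap_measurableType => i _.
  apply: sub_sigma_algebra; exists i => //.
  by exists (B i) => //; rewrite setTI.
Qed.

(** The number [k] of revealed claims is a fixed index, unrelated to the number of claims that have
    occurred. The cylinders form a pi-system, which is what the uniqueness of measures requires. *)
Definition past (n k : nat) : set (set T) :=
  [set A | exists M B, (forall i, measurable (B i)) /\ A = cylinder n k M B].

Lemma past_setI_closed (n k : nat) : setI_closed (past n k).
Proof.
move=> _ _ [M [B [mB ->]]] [M' [B' [mB' ->]]].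
exists (fun i => M i `&` M' i), (fun i => B i `&` B' i); split.
  by move=> i; exact: measurableI.
apply/seteqP; split => w /=.
  move=> [[H1 H2] [H3 H4]]; split => i ni; split; by [exact: H1|exact: H2|exact: H3|exact: H4].
by move=> [H1 H2]; split; split => i ni; by [have [] := H1 i ni|have [] := H2 i ni].
Qed.

Lemma past_measurable (n k : nat) : <<s past n k >> `<=` measurable.
Proof.
apply: smallest_sub; first exact: sigma_algebra_measurable.
move=> _ [M [B [mB ->]]].
rewrite (_ : cylinder _ _ _ _ = (\bigcap_(i < n) (incr i @^-1` M i)) `&`
   (\bigcap_(i < k) (S i @^-1` B i)))//.
apply: measurableI; apply: bigcap_measurableType => i _.
  by rewrite -[_ @^-1` _]setTI; exact: measurable_incr.
by rewrite -[_ @^-1` _]setTI; exact: measurable_funP.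
Qed.

Lemma measurable_past_incr (n k i : nat) : (i < n)%N ->
  measurable_fun [set: g_sigma_algebraType (past n k)]
    (fun w : g_sigma_algebraType (past n k) => incr i w).
Proof.
move=> ni _ A _; apply: sub_sigma_algebra.
exists (fun j => if j == i then A else setT), (fun=> setT); split => //.
apply/seteqP; split => w /=.
  by move=> [_ H]; split => // j nj; case: eqP => // ->.
by move=> [/(_ i ni)]; rewrite eqxx.
Qed.

Lemma measurable_past_claim (n k i : nat) : (i < k)%N ->
  measurable_fun [set: g_sigma_algebraType (past n k)]
    (fun w : g_sigma_algebraType (past n k) => S i w).
Proof.
move=> ni _ A mA; apply: sub_sigma_algebra.
exists (fun=> setT), (fun j => if j == i then A else setT); split => //.
  by move=> j; case: ifP.
apply/seteqP; split => w /=.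
  by move=> [_ H]; split => // j nj; case: eqP => // ->.
by move=> [_ /(_ i ni)]; rewrite eqxx.
Qed.

(** With E the event on the increment [n] and the claim [k], the finite measures A -> P (A and E)
    and A -> P A * P E agree on cylinders, by the product formula with one more coordinate of each
    kind. They therefore agree on the generated sigma-algebra. *)
Lemma past_indep (n k : nat) (A : set T) (M : set nat) (B : set R) :
  <<s past n k >> A -> measurable B ->
  P (A `&` (incr n @^-1` M `&` S k @^-1` B)) =
  (P A * (P (incr n @^-1` M) * P (S k @^-1` B)))%E.
Proof.
move=> sA mB.
have mM : measurable (incr n @^-1` M).
  by rewrite -[_ @^-1` _]setTI; exact: measurable_incr.
have mSB : measurable (S k @^-1` B).
  by rewrite -[_ @^-1` _]setTI; exact: measurable_funP.
have mMB : measurable (incr n @^-1` M `&` S k @^-1` B) by exact: measurableI.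
set a := (X in (P A * X)%E).
have afin : a \is a fin_num by rewrite fin_numM//; exact: fin_num_measure.
have a0 : 0 <= fine a by rewrite fine_ge0// mule_ge0.
pose m1 : {measure set T -> \bar R} := mrestr P mMB.
pose m2 : {measure set T -> \bar R} := mscale (NngNum a0) P.
have -> : (P A * a)%E = m2 A by rewrite /m2/= /mscale/= fineK// muleC.
have trace : [set X | past n k X /\ X `<=` setT] = past n k.
  by apply/seteqP; split => [X []//|X]; split.
have m12 X : past n k X -> m1 X = m2 X.
  move=> [M' [B' [mB' ->]]]; rewrite /m1/= /m2/= /mscale/= /mrestr fineK// muleC.
  (* Intersecting with the event on the new coordinates gives a cylinder of size [n.+1], [k.+1] that
     keeps the old constraints below [n] and [k]. *)
  pose M1 i := if i == n then M else M' i.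
  pose B1 i := if i == k then B else B' i.
  have mB1 i : measurable (B1 i) by rewrite /B1; case: eqP.
  rewrite [X in P X = _](_ : _ = cylinder n.+1 k.+1 M1 B1); last first.
    rewrite /cylinder; apply/seteqP; split => w /=.
      move=> [[H1 H2] [H3 H4]]; split => i; rewrite ltnS leq_eqVlt /M1 /B1.
        by case: eqP => [->//|_ /= /H1].
      by case: eqP => [->//|_ /= /H2].
    move=> [H1 H2]; split; split.
    - move=> i ni; have := H1 i (leqW ni); rewrite /M1; case: eqP => // ein.
      by move: ni; rewrite ein ltnn.
    - move=> i ni; have := H2 i (leqW ni); rewrite /B1; case: eqP => // ein.
      by move: ni; rewrite ein ltnn.
    - by have := H1 n (ltnSn n); rewrite /M1 eqxx.
    - by have := H2 k (ltnSn k); rewrite /B1 eqxx.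
  have E1 : (\prod_(0 <= i < n) P (incr i @^-1` M1 i) =
             \prod_(0 <= i < n) P (incr i @^-1` M' i))%E.
    apply: eq_big_nat => i /andP[_ ni].
    by rewrite /M1 ifF//; apply/eqP => e; rewrite e ltnn in ni.
  have E2 : (\prod_(0 <= i < k) P (S i @^-1` B1 i) =
             \prod_(0 <= i < k) P (S i @^-1` B' i))%E.
    apply: eq_big_nat => i /andP[_ ni].
    by rewrite /B1 ifF//; apply/eqP => e; rewrite e ltnn in ni.
  rewrite !prob_cylinder// !big_nat_recr//= E1 E2 /M1 /B1 !eqxx.
  by rewrite /a muleACA.
apply: (@g_sigma_algebra_measure_unique_trace d R T (past n k) setT measurableT _ _ m1 m2) => //.
- by rewrite trace => X /(@sub_sigma_algebra _ setT)/past_measurable.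
- rewrite trace; exact: past_setI_closed.
- apply: m12; exists (fun=> setT), (fun=> setT); split => //.
  by apply/seteqP; split.
- by move=> X []/m12.
- by rewrite /m1/= /mrestr (le_lt_trans (probability_le1 _ _)) ?ltry//; exact: measurableI.
- by rewrite trace.
Qed.

Lemma measurable_past_count (n n0 k : nat) : (n0 <= n)%N ->
  measurable_fun [set: g_sigma_algebraType (past n k)]
    (fun w : g_sigma_algebraType (past n k) => N (h * n0%:R) w).
Proof.
move=> n0n.
rewrite (_ : (fun _ => _) = fun w => \sum_(i < n0) incr i w)%N; last first.
  by apply/funext => w; rewrite sum_incr.
elim: n0 n0n => [_|m IH mn].
  by under eq_fun do rewrite big_ord0; exact: measurable_cst.
under eq_fun do rewrite big_ord_recr/=.
apply: measurable_fun_addn; first exact: IH (ltnW mn).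
exact: measurable_past_incr.
Qed.

(* [Z] is a function of the increments [0, ..., n-1] and of the claims that
   have occurred by the grid time [n0]. *)
Definition adapted (d1 : measure_display) (T1 : measurableType d1)
    (n n0 : nat) (Z : T -> T1) : Prop :=
  forall k, exists Zk : g_sigma_algebraType (past n k) -> T1,
    measurable_fun setT Zk /\ (forall w, N (h * n0%:R) w = k -> Z w = Zk w).

Lemma adapted_preimage (d1 : measure_display) (T1 : measurableType d1)
    (n n0 : nat) (Z : T -> T1) (A : set T1) (k : nat) :
  (n0 <= n)%N -> adapted n n0 Z -> measurable A ->
  <<s past n k >> (Z @^-1` A `&` N (h * n0%:R) @^-1` [set k]).
Proof.
move=> n0n /(_ k)[Zk [mZk ZZk]] mA.
rewrite (_ : _ `&` _ = Zk @^-1` A `&` N (h * n0%:R) @^-1` [set k]); last first.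
  by apply/seteqP; split => w /= [] + Nk; rewrite ZZk.
suff : measurable (Zk @^-1` A `&`
  (N (h * n0%:R) @^-1` [set k] : set (g_sigma_algebraType (past n k)))) by [].
apply: measurableI.
  by rewrite -[_ @^-1` _]setTI; exact: mZk.
by rewrite -[_ @^-1` _]setTI; exact: measurable_past_count.
Qed.

Lemma adapted_measurable (d1 : measure_display) (T1 : measurableType d1)
    (n n0 : nat) (Z : T -> T1) :
  (n0 <= n)%N -> adapted n n0 Z -> measurable_fun setT Z.
Proof.
move=> n0n aZ _ A mA; rewrite setTI.
rewrite (_ : _ @^-1` _ = \bigcup_k (Z @^-1` A `&` N (h * n0%:R) @^-1` [set k])).
  apply: bigcupT_measurable => k; apply: (@past_measurable n k).
  exact: adapted_preimage n0n aZ mA.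
rewrite -setI_bigcupr -preimage_bigcup; apply/seteqP; split => w /=; last by case.
by move=> H; split => //; exists (N (h * n0%:R) w).
Qed.

(** Claims are numbered from 0, so the count at a grid time is exactly the index of the first claim
    still to come. *)
Definition next_claim (n : nat) (w : T) : R := S (N (h * n%:R) w) w.

Lemma measurable_next_claim (n : nat) : measurable_fun setT (next_claim n).
Proof.
move=> _ A mA; rewrite setTI.
rewrite (_ : _ @^-1` _ = \bigcup_k (S k @^-1` A `&` N (h * n%:R) @^-1` [set k])).
  apply: bigcupT_measurable => k; apply: measurableI.
    by rewrite -[_ @^-1` _]setTI; exact: measurable_funP.
  by rewrite -[_ @^-1` _]setTI; exact: measurable_funP.
apply/seteqP; split => w /=.
  by move=> H; exists (N (h * n%:R) w).
by move=> [k _ [/= + Nk]]; rewrite /next_claim Nk.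
Qed.

(** On the event that the count at [n0] is k, [next_claim n0] is [S k] and [Z] depends on the
    history with k claims, so [past_indep] applies. Since the claims share one law, the factor does
    not depend on k and leaves the sum. Allowing [n0 < n] lets [Z] contain the increment of the step
    in progress. *)
Lemma adapted_indep (d1 : measure_display) (T1 : measurableType d1)
    (n n0 : nat) (Z : T -> T1) (A : set T1) (M : set nat) (B : set R) :
  (n0 <= n)%N -> adapted n n0 Z -> measurable A -> measurable B ->
  P (Z @^-1` A `&` (incr n @^-1` M `&` next_claim n0 @^-1` B)) =
  (P (Z @^-1` A) * (P (incr n @^-1` M) * P (S 0 @^-1` B)))%E.
Proof.
move=> n0n aZ mA mB.
have mZA : measurable (Z @^-1` A).
  by rewrite -[_ @^-1` _]setTI; exact: adapted_measurable aZ _ _ _.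
have mM : measurable (incr n @^-1` M).
  by rewrite -[_ @^-1` _]setTI; exact: measurable_incr.
have mSB : measurable (S 0 @^-1` B).
  by rewrite -[_ @^-1` _]setTI; exact: measurable_funP.
set a := (P (incr n @^-1` M) * P (S 0 @^-1` B))%E.
have afin : a \is a fin_num by rewrite fin_numM//; exact: fin_num_measure.
rewrite (probability_countable_split (N (h * n0%:R))); last first.
  apply: measurableI => //; apply: measurableI => //.
  by rewrite -[_ @^-1` _]setTI; exact: measurable_next_claim.
rewrite [P (Z @^-1` A)](probability_countable_split (N (h * n0%:R)))//.
rewrite muleC -(fineK afin) -nneseriesZl//=.
apply: eq_eseriesr => k _; rewrite muleC fineK// /a.
have -> : P (S 0 @^-1` B) = P (S k @^-1` B) := S_law 0 k mB.
rewrite -past_indep//; last exact: adapted_preimage n0n aZ mA.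
congr (P _); apply/seteqP; split => w /=; rewrite /next_claim /=.
  by move=> [[? []]] + + Nk; rewrite Nk.
by move=> [[? Nk] [] ? ?]; rewrite Nk.
Qed.

End cylinders.

(** * Integrals against the exponential law *)

Section density.
Context (d : measure_display) (T : measurableType d) (R : realType).
Variables (mu nu : {measure set T -> \bar R}) (g : T -> R).
Hypotheses (mg : measurable_fun setT g) (g0 : forall x, 0 <= g x).
Hypothesis nuE : forall A, measurable A -> nu A = (\int[mu]_(x in A) (g x)%:E)%E.
Local Open Scope ereal_scope.
Import HBNNSimple.

Let indic_density A : measurable A ->
  \int[nu]_x (\1_A x)%:E = \int[mu]_x ((\1_A x)%:E * (g x)%:E).
Proof.
move=> mA; rewrite integral_indic// setIT nuE// integral_mkcond.
apply: eq_integral => x _; rewrite patchE indicE; case: ifPn => xA.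
  by rewrite mul1e.
by rewrite mul0e.
Qed.

Let nnsfun_density (h : {nnsfun T >-> R}) :
  \int[nu]_x (h x)%:E = \int[mu]_x ((h x)%:E * (g x)%:E).
Proof.
under [LHS]eq_integral do rewrite fimfunE -fsumEFin//.
rewrite [LHS]ge0_integral_fsum//; last 2 first.
  - by move=> r; exact/measurable_EFinP/measurableT_comp.
  - by move=> n x _; rewrite EFinM nnfun_muleindic_ge0.
under [RHS]eq_integral.
  move=> x xD; rewrite fimfunE -fsumEFin// muleC ge0_mule_fsumr; last first.
    by move=> r; rewrite EFinM nnfun_muleindic_ge0.
  over.
rewrite [RHS]ge0_integral_fsum//; last 2 first.
  - move=> r; apply: emeasurable_funM; first exact/measurable_EFinP.
    by apply/measurable_EFinP; do 2 apply/measurableT_comp => //.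
  - move=> n x _; rewrite mule_ge0//; first by rewrite lee_fin.
    by rewrite EFinM nnfun_muleindic_ge0.
apply: eq_fsbigr => r /[!inE] -[x0 _ <-]; rewrite integralZl_indic_nnsfun//=.
under [RHS]eq_integral do rewrite EFinM muleCA [X in _ * X]muleC.
rewrite ge0_integralZl//.
- by rewrite -indic_density.
- apply: emeasurable_funM; last exact/measurable_EFinP.
  by apply/measurable_EFinP; exact: measurable_indic.
- by move=> t _; rewrite mule_ge0// lee_fin// indicE.
- by rewrite lee_fin.
Qed.

Lemma ge0_integral_density (f : T -> \bar R) :
  measurable_fun setT f -> (forall x, 0 <= f x) ->
  \int[nu]_x f x = \int[mu]_x (f x * (g x)%:E).
Proof.
move=> mf f0; pose f_ := nnsfun_approx measurableT mf.
transitivity (limn (fun n => \int[nu]_x (f_ n x)%:E)).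
  rewrite -monotone_convergence//=.
  - apply: eq_integral => x _; apply/esym/cvg_lim => //=.
    exact: cvg_nnsfun_approx.
  - by move=> n; exact/measurable_EFinP.
  - by move=> n x _; rewrite lee_fin.
  - by move=> x _ a b ab; rewrite lee_fin//; exact/lefP/nd_nnsfun_approx.
transitivity (limn (fun n => \int[mu]_x ((f_ n x)%:E * (g x)%:E))).
  by congr (limn _); apply/funext => n; exact: nnsfun_density.
rewrite -monotone_convergence//=.
- apply: eq_integral => x _; apply/cvg_lim => //=.
  by apply: cvgeZr => //; exact: cvg_nnsfun_approx.
- by move=> n; apply: emeasurable_funM; exact/measurable_EFinP.
- by move=> n x _; rewrite mule_ge0// lee_fin.
- move=> x _ a b ab; rewrite -!EFinM lee_fin ler_wpM2r//.
  by exact/lefP/nd_nnsfun_approx.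
Qed.

End density.

Section exponential_integrals.
Context (R : realType).
Local Notation mu := (@lebesgue_measure R).
Variables (gamma : R) (nu : probability R R).
Hypothesis gamma_gt0 : 0 < gamma.
Hypothesis nuE : forall A, measurable A -> nu A = exponential_prob gamma A.

(* [lebesgue_measure] lives on [measurableTypeR R], whose display differs from
   the default one of [R]; the identity transports [nu] there. *)
Let idR (x : R) : measurableTypeR R := x.

Let measurable_idR : @measurable_fun _ _ R (measurableTypeR R) [set: R] idR.
Proof. by move=> _ A mA; rewrite setTI. Qed.

HB.instance Definition _ :=
  @isMeasurableFun.Build _ _ R (measurableTypeR R) idR measurable_idR.

Let nu' : {measure set (measurableTypeR R) -> \bar R} := distribution nu idR.

Let nu'E A : measurable A ->
  nu' A = (\int[mu]_(x in A) (exponential_pdf gamma x)%:E)%E.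
Proof. by move=> mA; exact: nuE. Qed.

Let integral_nu (f : R -> \bar R) : measurable_fun setT f ->
  (forall x, 0 <= f x)%E ->
  (\int[nu]_s f s = \int[mu]_s (f s * (exponential_pdf gamma s)%:E))%E.
Proof.
move=> mf f0; rewrite -(ge0_integral_density (nu := nu') _ _ nu'E)//.
- by rewrite ge0_integral_distribution.
- exact: measurable_exponential_pdf.
- by move=> x; exact/exponential_pdf_ge0/ltW.
Qed.

Let pdf_ge0 (a : R) : 0 < a -> forall x, 0 <= exponential_pdf a x.
Proof. by move=> a0 x; exact/exponential_pdf_ge0/ltW. Qed.

(** An exponential tilt of an exponential density is again one, up to a constant, so the integrals
    below reduce to masses of exponential laws. The parameter [theta] may be negative: the overshoot
    uses [theta = - r]. *)
Lemma exponential_tilt (theta : R) (x : R) : 0 < gamma + theta ->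
  expR (- theta * x) * exponential_pdf gamma x =
  gamma / (gamma + theta) * exponential_pdf (gamma + theta) x.
Proof.
move=> gt0; have [x0|x0] := ltP x 0; first by rewrite !lt0_exponential_pdf// !mulr0.
rewrite !exponential_pdfE// mulrCA -expRD mulrA divfK ?gt_eqF//.
by congr (_ * expR _); ring.
Qed.

Lemma exponential_laplace (theta : R) : 0 < gamma + theta ->
  (\int[nu]_s (expR (- theta * s))%:E = (gamma / (gamma + theta))%:E)%E.
Proof.
move=> gt0.
have me : measurable_fun [set: R] (fun s => (expR (- theta * s))%:E).
  by apply/measurable_EFinP; apply: measurableT_comp => //.
rewrite integral_nu//.
  under eq_integral do rewrite -EFinM exponential_tilt// EFinM.
  rewrite ge0_integralZl//=.
  - by rewrite integral_exponential_pdf// mule1.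
  - by apply/measurable_EFinP; exact: measurable_exponential_pdf.
  - by move=> x _; rewrite lee_fin pdf_ge0.
  - by rewrite lee_fin divr_ge0// ltW.
Qed.

Let exponential_prob_itv (a y : R) : 0 < a -> 0 <= y ->
  exponential_prob a `[0, y] = (1 - expR (- a * y))%:E.
Proof.
move=> a0; rewrite le_eqVlt => /orP[/eqP <-|y0].
  by rewrite set_itv1 mulr0 expR0 subrr /exponential_prob integral_set1.
by rewrite exponential_prob_itv0c.
Qed.

Let integral_pdf_le (a y : R) : 0 < a -> 0 <= y ->
  (\int[mu]_(s in `]-oo, y]) (exponential_pdf a s)%:E =
   (1 - expR (- a * y))%:E)%E.
Proof.
move=> a0 y0; rewrite -exponential_prob_itv// /exponential_prob.
rewrite [LHS]integral_mkcond [RHS]integral_mkcond; apply: eq_integral => s _.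
rewrite !patchE !mem_setE !in_itv/=.
case: (leP s y); rewrite ?andbT ?andbF//=.
by case: (leP 0 s) => //= s0 _; rewrite lt0_exponential_pdf.
Qed.

Let integral_pdf_gt (a y : R) : 0 < a -> 0 <= y ->
  (\int[mu]_(s in `]y, +oo[) (exponential_pdf a s)%:E = (expR (- a * y))%:E)%E.
Proof.
move=> a0 y0; have := integral_exponential_pdf a0.
have splitR : `]-oo, y] `|` `]y, +oo[ = [set: R] by rewrite -setCitvl setUv.
rewrite -splitR ge0_integral_setU//=; first last.
- by rewrite -setCitvl; exact/disj_setPCl.
- by move=> s _; rewrite lee_fin pdf_ge0.
- by apply/measurable_EFinP; apply: measurable_funTS; exact: measurable_exponential_pdf.
rewrite integral_pdf_le// => H.
rewrite -[LHS](@addeK _ (1 - expR (- a * y))%:E)//.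
by rewrite [X in (X - _)%E]addeC H -EFinB; congr (_%:E); ring.
Qed.

(* The constant [gamma / (gamma - r)] is the mean of [expR (r * s)] under the
   exponential law, so that by lack of memory the overshoot over [y] is
   accounted for exactly. *)
Lemma exponential_overshoot (r y : R) : 0 < r -> r < gamma -> 0 <= y ->
  (\int[nu]_s (if s <= y then expR (- r * (y - s)) else gamma / (gamma - r))%:E =
  (gamma / (gamma - r) * expR (- r * y))%:E)%E.
Proof.
move=> r0 rg y0; have gr0 : 0 < gamma - r by rewrite subr_gt0.
have mf : measurable_fun [set: R] (fun s =>
    (if s <= y then expR (- r * (y - s)) else gamma / (gamma - r))%:E).
  apply/measurable_EFinP; apply: measurable_fun_ifT => //.
    exact: measurable_fun_ler.
  apply: measurableT_comp => //; apply: measurable_funM => //.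
  exact: measurable_funB.
have f0 s : (0 <= (if s <= y then expR (- r * (y - s)) else gamma / (gamma - r))%:E)%E.
  by rewrite lee_fin; case: ifP => _; rewrite ?expR_ge0// divr_ge0// ltW.
rewrite integral_nu//.
have splitR : `]-oo, y] `|` `]y, +oo[ = [set: R] by rewrite -setCitvl setUv.
rewrite -[X in integral _ X _]splitR ge0_integral_setU//=; first last.
- by rewrite -setCitvl; exact/disj_setPCl.
- by move=> s _; rewrite mule_ge0// lee_fin pdf_ge0.
- rewrite splitR; apply: emeasurable_funM => //.
  by apply/measurable_EFinP; exact: measurable_exponential_pdf.
under eq_integral => s.
  rewrite inE/= in_itv/= => sy; rewrite sy -EFinM.
  rewrite (_ : - r * (y - s) = - r * y + - (- r) * s); last by ring.
  rewrite expRD -mulrA exponential_tilt// EFinM [X in (_ * X)%E]EFinM.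
  over.
have c0 : 0 <= gamma / (gamma - r) by rewrite divr_ge0// ltW.
have mpdf (a : R) D : measurable D ->
    @measurable_fun _ _ (measurableTypeR R) _ D (fun s => (exponential_pdf a s)%:E).
  move=> mD; apply/measurable_EFinP/measurable_funTS.
  exact: measurable_exponential_pdf.
rewrite ge0_integralZl//=; first last.
- by move=> s _; rewrite mule_ge0// lee_fin// pdf_ge0.
- by apply: emeasurable_funM => //; exact: mpdf.
rewrite ge0_integralZl//=; first last.
- by move=> s _; rewrite lee_fin// pdf_ge0.
- exact: mpdf.
under [X in (_ + X)%E]eq_integral => s.
  rewrite inE/= in_itv/= andbT => ys; rewrite leNgt ys/=.
  over.
rewrite ge0_integralZl//=; first last.
- by move=> s _; rewrite lee_fin// pdf_ge0.
- exact: mpdf.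
rewrite integral_pdf_le// integral_pdf_gt// ?(ltW y0)// -!EFinM -EFinD; congr (_%:E).
(* The claims up to [y] contribute c exp(-r y) (1 - exp(-(gamma - r) y)) and those beyond it c
   exp(-gamma y); the two boundary terms cancel, which is what forces the value [c] below 0. *)
rewrite (_ : - gamma * y = - r * y + - (gamma - r) * y); last by ring.
by rewrite expRD; ring.
Qed.

End exponential_integrals.

(** * One step of the stopped walk *)

Section stopped_sequence.
Context (R : realDomainType).
Implicit Types (X : nat -> R) (n : nat).

(** The sequence is frozen at its first negative value, so the sign of the stopped value alone
    records whether passage has taken place. *)
Fixpoint stopped X n : R :=
  if n is m.+1 then (if 0 <= stopped X m then X m.+1 else stopped X m) else X 0.

Lemma stopped_ge0 X n : 0 <= stopped X n -> stopped X n = X n.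
Proof. by case: n => //= n; case: ifPn => // /negPf ->. Qed.

Lemma stopped_step X n : 0 <= stopped X n -> stopped X n.+1 = X n.+1.
Proof. by move=> /= ->. Qed.

Lemma stopped_ge0S X n : 0 <= stopped X n.+1 -> 0 <= stopped X n.
Proof. by move=> /=; case: ifPn => // /negPf ->. Qed.

Lemma stopped_ge0P X n :
  reflect (forall k, (k <= n)%N -> 0 <= X k) (0 <= stopped X n).
Proof.
apply: (iffP idP) => [|H].
  elim: n => [H k|n IH H k].
    by rewrite leqn0 => /eqP ->.
  rewrite leq_eqVlt => /predU1P[->|]; first by rewrite -stopped_ge0.
  by rewrite ltnS; exact/IH/stopped_ge0S.
elim: n H => [|n IH] H /=; first exact: H.
by rewrite IH ?H// => k kn; apply: H; exact: leqW.
Qed.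

Lemma eq_stopped X X' n : (forall k, (k <= n)%N -> X k = X' k) ->
  stopped X n = stopped X' n.
Proof.
elim: n => [|n IH] XX' /=; first exact: XX'.
by rewrite IH ?XX'// => k kn; exact/XX'/leqW.
Qed.

End stopped_sequence.

Lemma measurable_stopped (d : measure_display) (T : measurableType d)
    (R : realType) (X : nat -> T -> R) (n : nat) :
  (forall k, (k <= n)%N -> measurable_fun setT (X k)) ->
  measurable_fun setT (fun w => stopped (X ^~ w) n).
Proof.
elim: n => [|n IH] mX /=; first exact: mX.
have mY : measurable_fun setT (fun w => stopped (X ^~ w) n).
  by apply: IH => k kn; exact/mX/leqW.
apply: measurable_fun_ifT => //; last exact: mX.
exact: measurable_fun_ler.
Qed.

Section one_step.
Context (d : measure_display) (T : measurableType d) (R : realType).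
Variable P : probability T R.
Variables (lambda gamma p x : R) (N : R -> {RV P >-> nat}) (S : nat -> {RV P >-> R}).
Hypotheses (p_gt0 : 0 < p) (lambda_gt0 : 0 < lambda) (gamma_gt0 : 0 < gamma).
Hypothesis N_poisson : is_poisson_process lambda N.
Hypothesis S_law : forall (i : nat) (A : set R), measurable A ->
  distribution P (S i) A = exponential_prob gamma A.
Hypothesis S_indep : mutually_independent P (fun (i : nat) (w : T) => S i w).
Hypothesis NS_indep : independent_sigma P
  (sigma_generated [set s : R | 0 <= s] (fun (s : R) (w : T) => N s w))
  (sigma_generated [set: nat] (fun (i : nat) (w : T) => S i w)).
Variable h : R.
Hypothesis h_gt0 : 0 < h.

Local Notation incr := (incr N h).
Local Notation next_claim := (next_claim N S h).

Let S_eq_law (i j : nat) (A : set R) : measurable A ->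
  distribution P (S i) A = distribution P (S j) A.
Proof. by move=> mA; rewrite !S_law. Qed.

Definition grid_walk (n : nat) (w : T) : R := cramer_lundberg x p N S (h * n%:R) w.

Definition grid_stopped (n : nat) (w : T) : R := stopped (grid_walk ^~ w) n.

Lemma count_le (n m : nat) (w : T) : (n <= m)%N ->
  (N (h * n%:R) w <= N (h * m%:R) w)%N.
Proof.
move=> nm; apply: (poisson_process_nondecreasing N_poisson).
  by rewrite mulr_ge0// ltW.
by rewrite ler_pM2l// ler_nat.
Qed.

Lemma grid_walkS (n : nat) (w : T) : grid_walk n.+1 w =
  grid_walk n w + p * h - \sum_(i < incr n w) S (N (h * n%:R) w + i)%N w.
Proof.
rewrite /grid_walk /cramer_lundberg.
have -> : N (h * n.+1%:R) w = (N (h * n%:R) w + incr n w)%N.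
  by rewrite subnKC// count_le.
rewrite big_split_ord/= -natr1; ring.
Qed.

Lemma grid_walk_incr0 (n : nat) (w : T) : incr n w = 0%N ->
  grid_walk n.+1 w = grid_walk n w + p * h.
Proof. by move=> i0; rewrite grid_walkS i0 big_ord0 subr0. Qed.

Lemma grid_walk_incr1 (n : nat) (w : T) : incr n w = 1%N ->
  grid_walk n.+1 w = grid_walk n w + p * h - next_claim n w.
Proof. by move=> i1; rewrite grid_walkS i1 big_ord1 addn0. Qed.

Lemma adapted_grid_stopped (n m : nat) : (n <= m)%N ->
  adapted N S h m n (grid_stopped n).
Proof.
move=> nm k.
(* On the event that the count at [n] is [k], all earlier counts are at most [k]. Every claim sum is
   then a sum over the fixed range [k] with the later claims masked, a function of the history with
   [k] claims. *)
pose Xk j (w : g_sigma_algebraType (past N S h m k)) : R :=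
  x + p * (h * j%:R) -
  \sum_(i < k) (if (i < N (h * j%:R)%R w)%N then S i w else 0).
exists (fun w => stopped (Xk ^~ w) n); split.
  apply: measurable_stopped => j jn; apply: measurable_funB => //.
  apply: measurable_sum => i; apply: measurable_fun_ifT => //.
    apply: measurable_fun_ltn => //.
    exact: (measurable_past_count N_poisson h_gt0 (leq_trans jn nm)).
  exact: measurable_past_claim.
move=> w Nk; apply: eq_stopped => j jn; congr (_ - _).
by rewrite -big_mkcond/= -(big_ord_widen _ (fun i => S i w))// -Nk count_le.
Qed.

(** The history includes the increment [n] but only the claims that precede this step; this makes
    the first claim of the step independent of both the position and the number of claims in the
    step. *)
Lemma adapted_grid_stopped_incr (n : nat) :
  adapted N S h n.+1 n (fun w => (grid_stopped n w, incr n w)).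
Proof.
move=> k; have [Zk [mZk ZZk]] := adapted_grid_stopped (leqnSn n) k.
exists (fun w => (Zk w, incr n w)); split; last by move=> w /ZZk ->.
apply: measurable_fun_pair => //.
exact: measurable_past_incr.
Qed.

Lemma measurable_grid_stopped (n : nat) : measurable_fun setT (grid_stopped n).
Proof. exact: (adapted_measurable N_poisson h_gt0 (leqnn n) (adapted_grid_stopped (leqnn n))). Qed.

Let u := lambda * h.
Let u_gt0 : 0 < u. Proof. exact: mulr_gt0. Qed.

Lemma prob_incr (n m : nat) :
  P (incr n @^-1` [set m]) = (poisson_pmf u m)%:E.
Proof.
have -> : u = lambda * (h * n.+1%:R - h * n%:R).
  by rewrite -mulrBr -[n.+1%:R]natr1 addrAC subrr add0r mulr1.
apply: (poisson_process_law N_poisson m (s := h * n%:R) (t := h * n.+1%:R)).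
  by rewrite mulr_ge0// ltW.
by rewrite ltr_pM2l// ltr_nat.
Qed.

Lemma next_claim_law (n : nat) (B : set R) : measurable B ->
  P (next_claim n @^-1` B) = exponential_prob gamma B.
Proof.
move=> mB.
have := adapted_indep N_poisson S_eq_law S_indep NS_indep h_gt0 setT
  (leqnn n) (adapted_grid_stopped (leqnn n)) measurableT mB.
rewrite !preimage_setT !setTI probability_setT !mul1e => ->; exact: S_law.
Qed.

Local Open Scope ereal_scope.

Let stoppedRV n : {RV P >-> R} := mfun_Sub (mem_set (measurable_grid_stopped n)).
Let incrRV n : {RV P >-> nat} := mfun_Sub (mem_set (measurable_incr N h n)).
Let claimRV n : {RV P >-> R} := mfun_Sub (mem_set (measurable_next_claim N S h n)).

Lemma integral_grid_stopped_incr (n m : nat) (f : R -> \bar R) :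
  measurable_fun setT f -> (forall y, 0 <= f y) ->
  \int[P]_w (if incr n w == m then f (grid_stopped n w) else 0) =
  (poisson_pmf u m)%:E * \int[P]_w f (grid_stopped n w).
Proof.
move=> mf f0.
pose F (z : (R * nat)%type) := if z.2 == m then f z.1 else 0.
have mF : measurable_fun [set: (R * nat)%type] F.
  apply: measurable_fun_ifT => //; last exact: measurableT_comp.
  exact: measurable_fun_eqn.
have F0 z : 0 <= F z by rewrite /F; case: ifP.
have mfY : measurable_fun setT (fun w => f (grid_stopped n w)).
  by apply: measurableT_comp => //; exact: measurable_grid_stopped.
have ind (A : set R) (B : set nat) : measurable A -> measurable B ->
    P (stoppedRV n @^-1` A `&` incrRV n @^-1` B) =
    P (stoppedRV n @^-1` A) * P (incrRV n @^-1` B).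
  move=> mA mB.
  have := adapted_indep N_poisson S_eq_law S_indep NS_indep h_gt0 B
    (leqnn n) (adapted_grid_stopped (leqnn n)) mA measurableT.
  by rewrite !preimage_setT !setIT probability_setT !mule1.
transitivity (\int[P]_w F (stoppedRV n w, incrRV n w)); first by [].
rewrite (indep_integral mF F0 ind)//.
transitivity (\int[P]_w ((poisson_pmf u m)%:E * f (grid_stopped n w))).
  apply: eq_integral => w _.
  transitivity (\int[distribution P (incrRV n)]_s (f (grid_stopped n w) * (\1_[set m] s)%:E)).
    apply: eq_integral => k _; rewrite /F/= indicE.
    have -> : (k \in [set m]) = (k == m) by apply/idP/eqP => [/set_mem|->]; rewrite ?inE.
    by case: eqP => _; rewrite ?mule1 ?mule0.
  rewrite ge0_integralZl//.
  - by rewrite integral_indic// setIT muleC -(prob_incr n).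
by rewrite ge0_integralZl// lee_fin poisson_pmf_ge0.
Qed.

Variable r : R.
Hypotheses (r_gt0 : (0 < r)%R) (r_lt : (r < gamma)%R).
Let c := (gamma / (gamma - r))%R.

(** The function F of the overview restricted to paths not yet ruined; its constant value [c] below
    0 is accounted for separately, at the moment of passage. *)
Definition alive_weight (n : nat) (w : T) : R :=
  if (0 <= grid_stopped n w)%R then expR (- r * grid_stopped n w) else 0%R.

(* The value of [F] after a claim [s] at level [y]; [c] is the mean of
   [expR (r * U)] for an undershoot [U] which is exponential of rate [gamma]. *)
Definition overshoot_weight (y s : R) : R :=
  if (s <= y)%R then expR (- r * (y - s)) else c.

Let gr_gt0 : (0 < gamma - r)%R. Proof. by rewrite subr_gt0. Qed.
Let c_gt0 : (0 < c)%R. Proof. exact: divr_gt0. Qed.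
Let c_ge1 : (1 <= c)%R.
Proof. by rewrite /c ler_pdivlMr// mul1r gerBl ltW. Qed.

Lemma measurable_alive_weight (n : nat) : measurable_fun setT (alive_weight n).
Proof.
have mY := measurable_grid_stopped n.
apply: measurable_fun_ifT => //; first exact: measurable_fun_ler.
apply: measurableT_comp => //; exact: measurable_funM.
Qed.

Lemma alive_weight_ge0 n w : (0 <= alive_weight n w)%R.
Proof. by rewrite /alive_weight; case: ifP => // _; rewrite expR_ge0. Qed.

Lemma alive_weight_le1 n w : (alive_weight n w <= 1)%R.
Proof.
rewrite /alive_weight; case: ifP => // y0.
by rewrite -expR0 ler_expR mulNr oppr_le0 mulr_ge0// ltW.
Qed.

Lemma overshoot_weight_ge0 y s : (0 <= overshoot_weight y s)%R.
Proof. by rewrite /overshoot_weight; case: ifP => _; rewrite ?expR_ge0// ltW. Qed.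

Lemma measurable_overshoot_weight :
  measurable_fun [set: (R * R)%type] (fun z => overshoot_weight z.1 z.2).
Proof.
apply: measurable_fun_ifT => //; first exact: measurable_fun_ler.
apply: measurableT_comp => //; apply: measurable_funM => //.
exact: measurable_funB.
Qed.

(** Only the end of the step is observed, so the claim may be treated as arriving after the whole
    premium [p * h]. The level it hits is then nonnegative and [exponential_overshoot] applies at
    that level, with position and increment frozen. *)
Lemma integral_one_claim (n : nat) :
  \int[P]_w (if (incr n w == 1%N) && (0 <= grid_stopped n w)%R
             then (overshoot_weight (grid_stopped n w + p * h) (next_claim n w))%:E
             else 0) =
  (poisson_pmf u 1 * (c * expR (- r * (p * h))))%:E *
  \int[P]_w (alive_weight n w)%:E.
Proof.
pose Z : {RV P >-> (R * nat)%type} := mfun_Sub (mem_set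
  (measurable_fun_pair (measurable_grid_stopped n) (measurable_incr N h n))).
pose F (z : ((R * nat) * R)%type) := if (z.1.2 == 1%N) && (0 <= z.1.1)%R
  then (overshoot_weight (z.1.1 + p * h) z.2)%:E else 0.
have mF : measurable_fun [set: ((R * nat) * R)%type] F.
  apply: measurable_fun_ifT => //.
    apply: measurable_and.
      by apply: measurable_fun_eqn => //; apply: measurableT_comp.
    by apply: measurable_fun_ler => //; apply: measurableT_comp.
  apply/measurable_EFinP.
  apply: (measurableT_comp (f := fun z : (R * R)%type => overshoot_weight z.1 z.2)
    (g := fun z : ((R * nat) * R)%type => ((z.1.1 + p * h)%R, z.2))).
    exact: measurable_overshoot_weight.
  apply: measurable_fun_pair => //; apply: measurable_funD => //.
  by apply: measurableT_comp.
have F0 z : 0 <= F z.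
  by rewrite /F; case: ifP => // _; rewrite lee_fin overshoot_weight_ge0.
have ind (A : set (R * nat)%type) (B : set R) : measurable A -> measurable B ->
    P (Z @^-1` A `&` claimRV n @^-1` B) = P (Z @^-1` A) * P (claimRV n @^-1` B).
  move=> mA mB.
  have := adapted_indep N_poisson S_eq_law S_indep NS_indep h_gt0 setT
    (leqnSn n) (adapted_grid_stopped_incr n) mA mB.
  rewrite !preimage_setT !setTI probability_setT !mul1e => H.
  rewrite (next_claim_law n mB); rewrite -(S_law 0 mB); exact: H.
transitivity (\int[P]_w F (Z w, claimRV n w)); first by [].
rewrite (indep_integral mF F0 ind).
transitivity (\int[P]_w (if incr n w == 1%N then
    ((c * expR (- r * (p * h)))%:E * (if (0 <= grid_stopped n w)%R
      then expR (- r * grid_stopped n w) else 0%R)%:E) else 0)).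
  apply: eq_integral => w _; rewrite /F/=.
  case: eqP => [i1|_] /=; last by rewrite integral0.
  case: ifPn => Y0; last by rewrite integral0 mule0.
  rewrite (@exponential_overshoot R gamma (distribution P (claimRV n)))//.
  - rewrite -EFinM; congr (_%:E); rewrite -[RHS]mulrA -expRD.
    by congr (_ * expR _)%R; ring.
  - exact: next_claim_law.
  - by rewrite addr_ge0// ltW// mulr_gt0.
rewrite (integral_grid_stopped_incr _ _ (f := fun y => (c * expR (- r * (p * h)))%:E *
    (if (0 <= y)%R then expR (- r * y) else 0%R)%:E)).
- rewrite ge0_integralZl//=.
  + by rewrite EFinM muleA.
  + by apply/measurable_EFinP; exact: measurable_alive_weight.
  + by move=> w _; rewrite lee_fin alive_weight_ge0.
  + by rewrite lee_fin mulr_ge0 ?expR_ge0// ltW.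
- apply: emeasurable_funM => //; apply/measurable_EFinP.
  apply: measurable_fun_ifT => //; first exact: measurable_fun_ler.
  by apply: measurableT_comp => //; exact: measurable_funM.
- move=> y; rewrite mule_ge0// lee_fin; last by case: ifP => //; rewrite expR_ge0.
  by rewrite mulr_ge0 ?expR_ge0// ltW.
Qed.

Lemma integral_no_claim (n : nat) :
  \int[P]_w (if incr n w == 0%N then (expR (- r * (p * h)) * alive_weight n w)%:E
             else 0) =
  (poisson_pmf u 0 * expR (- r * (p * h)))%:E * \int[P]_w (alive_weight n w)%:E.
Proof.
have := @integral_grid_stopped_incr n 0 (fun y => (expR (- r * (p * h)))%:E *
    (if (0 <= y)%R then expR (- r * y) else 0%R)%:E).
rewrite ge0_integralZl//=; first last.
- by move=> w _; rewrite lee_fin alive_weight_ge0.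
- by apply/measurable_EFinP; exact: measurable_alive_weight.
rewrite EFinM -muleA => <- //.
  apply: emeasurable_funM => //; apply/measurable_EFinP.
  apply: measurable_fun_ifT => //; first exact: measurable_fun_ler.
  by apply: measurableT_comp => //; exact: measurable_funM.
move=> y; rewrite mule_ge0// lee_fin ?expR_ge0//.
by case: ifP => //; rewrite expR_ge0.
Qed.

(* First passage below [0] at the grid time [n.+1], not [n]. *)
Definition passage (n : nat) : set T :=
  [set w | (0 <= grid_stopped n w)%R && (grid_stopped n.+1 w < 0)%R].

Lemma measurable_passage (n : nat) : measurable (passage n).
Proof.
rewrite -[passage n]setTI.
apply: (measurable_and (f := fun w => (0 <= grid_stopped n w)%R)
  (g := fun w => (grid_stopped n.+1 w < 0)%R) _ _ measurableT (Y := [set true])) => //.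
  by apply: measurable_fun_ler => //; exact: measurable_grid_stopped.
by apply: measurable_fun_ltr => //; exact: measurable_grid_stopped.
Qed.

(** The probability is 1 - exp(-u) (1 + u), and exp(-u) >= 1 - u bounds it by 1 - (1 - u) (1 + u),
    whatever the size of u. *)
Lemma prob_many_claims (n : nat) :
  P (incr n @^-1` [set m | (1 < m)%N]) <= (u ^+ 2)%:E.
Proof.
have -> : incr n @^-1` [set m | (1 < m)%N] =
    ~` (incr n @^-1` [set 0%N] `|` incr n @^-1` [set 1%N]).
  apply/seteqP; split => w /=; first by move=> + [] => /[swap] ->.
  by case: (incr n w) => [|[|//]] H; exfalso; apply: H; [left|right].
have m01 k : measurable (incr n @^-1` [set k]).
  by rewrite -[_ @^-1` _]setTI; exact: measurable_incr.
rewrite probability_setC//; last exact: measurableU.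
rewrite measureU//; last first.
  by apply/seteqP; split => // w [/= -> ].
rewrite [X in 1 - (X + _)%R](_ : _ = (poisson_pmf u 0)%:E); last exact: prob_incr.
rewrite [X in 1 - (_ + X)%R](_ : _ = (poisson_pmf u 1)%:E); last exact: prob_incr.
rewrite /poisson_pmf u_gt0 fact0 expr0 invr1 !mul1r expr1.
rewrite mulr1 -EFinD lee_fin.
have := expR_ge1Dx (- u); move: u_gt0; set e := expR _; set v := u => v0 ev.
have : (0 <= (1 + v) * (e - (1 - v)))%R by rewrite mulr_ge0//; lra.
lra.
Qed.

(** The factor [a] collects the no-claim term and the one-claim term, which are exact. The upper
    error is the bound [c] of F times the probability of several claims. *)
Lemma one_step (n : nat) (a : R) :
  a = (poisson_pmf u 0 * expR (- r * (p * h)) * (1 + c * u))%R ->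
  a%:E * \int[P]_w (alive_weight n w)%:E <=
  \int[P]_w (alive_weight n.+1 w)%:E + c%:E * P (passage n) <=
  a%:E * \int[P]_w (alive_weight n w)%:E + (c * u ^+ 2)%:E.
Proof.
move=> aE.
have mA m := measurable_alive_weight m.
have ip k : \int[P]_w (alive_weight k w)%:E \is a fin_num.
  rewrite ge0_fin_numE; last by apply: integral_ge0 => w _; rewrite lee_fin alive_weight_ge0.
  apply: (@le_lt_trans _ _ (\int[P]_w 1)); last first.
    by rewrite integral_cst// mul1e (le_lt_trans (probability_le1 P measurableT)) ?ltry.
  apply: ge0_le_integral => //.
  - by move=> w _; rewrite lee_fin alive_weight_ge0.
  - exact/measurable_EFinP.
  - by move=> w _; rewrite lee_fin alive_weight_le1.
pose L w := (if incr n w == 0%N then (expR (- r * (p * h)) * alive_weight n w)%:E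
             else 0).
pose M w := (if (incr n w == 1%N) && (0 <= grid_stopped n w)%R
             then (overshoot_weight (grid_stopped n w + p * h) (next_claim n w))%:E
             else 0).
pose H w := (alive_weight n.+1 w)%:E + c%:E * (\1_(passage n) w)%:E.
pose Z w := c%:E * (\1_(incr n @^-1` [set m | (1 < m)%N]) w)%:E.
have mL : measurable_fun setT L.
  apply: measurable_fun_ifT => //.
    by apply: measurable_fun_eqn => //; exact: measurable_incr.
  by apply/measurable_EFinP; exact: measurable_funM.
have mM : measurable_fun setT M.
  have mY := measurable_grid_stopped n.
  apply: measurable_fun_ifT => //.
    apply: measurable_and; last exact: measurable_fun_ler.
    by apply: measurable_fun_eqn => //; exact: measurable_incr.
  apply/measurable_EFinP.
  apply: (measurableT_comp (f := fun z : (R * R)%type => overshoot_weight z.1 z.2)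
    (g := fun w => ((grid_stopped n w + p * h)%R, next_claim n w))).
    exact: measurable_overshoot_weight.
  apply: measurable_fun_pair; last exact: measurable_next_claim.
  exact: measurable_funD.
have mmany : measurable (incr n @^-1` [set m | (1 < m)%N]).
  by rewrite -[_ @^-1` _]setTI; exact: measurable_incr.
have mH1 : measurable_fun setT (fun w => (alive_weight n.+1 w)%:E) by exact/measurable_EFinP.
have m1 (A : set T) : measurable A -> measurable_fun setT (fun w => c%:E * (\1_A w)%:E).
  by move=> mX; apply/measurable_EFinP; apply: measurable_funM => //; exact: measurable_indic.
have i1 (A : set T) : measurable A -> \int[P]_w (c%:E * (\1_A w)%:E) = c%:E * P A.
  move=> mX; rewrite ge0_integralZl//.
  - by rewrite integral_indic// setIT.
  - by apply/measurable_EFinP; exact: measurable_indic.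
  - by rewrite lee_fin ltW.
have L0 w : 0 <= L w.
  by rewrite /L; case: ifP => // _; rewrite lee_fin mulr_ge0 ?expR_ge0// alive_weight_ge0.
have M0 w : 0 <= M w.
  by rewrite /M; case: ifP => // _; rewrite lee_fin overshoot_weight_ge0.
have H0 w : 0 <= c%:E * (\1_(passage n) w)%:E.
  by rewrite mule_ge0// lee_fin// ltW.
have Z0 w : 0 <= Z w by rewrite mule_ge0// lee_fin// ltW.
have HE : \int[P]_w H w = \int[P]_w (alive_weight n.+1 w)%:E + c%:E * P (passage n).
  rewrite ge0_integralD//.
  - by rewrite i1//; exact: measurable_passage.
  - by move=> w _; rewrite lee_fin alive_weight_ge0.
  - exact/m1/measurable_passage.
have LME : \int[P]_w (L w + M w) = a%:E * \int[P]_w (alive_weight n w)%:E.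
  rewrite ge0_integralD// integral_no_claim integral_one_claim -muleDl ?fin_num_adde_defl//.
  rewrite -EFinD aE; congr (_%:E * _).
  rewrite /poisson_pmf u_gt0 fact0 expr0 invr1 !mul1r expr1.
  rewrite mulr1; ring.
have mH : measurable_fun setT H by apply: emeasurable_funD => //; exact/m1/measurable_passage.
have mZ : measurable_fun setT Z by exact: m1.
(* Pathwise comparison: no claim or one claim gives the equality [H w = L w + M w]; with several
   claims [L] and [M] vanish while [H] lies between 0 and [c], because [c >= 1] dominates the weight
   of a surviving path. On a path ruined before the step, [L], [M] and [H] all vanish. *)
have Hcases w : L w + M w <= H w <= L w + M w + Z w.
  have c0 : (0 <= c)%R by exact: ltW.
  rewrite /L /M /H /Z !indicE.
  have -> : (w \in incr n @^-1` [set m | (1 < m)%N]) = (1 < incr n w)%N.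
    by apply/idP/idP => [/set_mem//|]; rewrite inE.
  have -> : (w \in passage n) =
      (0 <= grid_stopped n w)%R && (grid_stopped n.+1 w < 0)%R.
    by apply/idP/idP => [/set_mem//|]; rewrite inE.
  rewrite -!EFinM.
  have [Y0|Y0] := leP 0%R (grid_stopped n w); last first.
    have -> : alive_weight n w = 0%R by rewrite /alive_weight leNgt Y0.
    have -> : alive_weight n.+1 w = 0%R.
      by rewrite /alive_weight; case: ifP => // /stopped_ge0S; rewrite leNgt Y0.
    rewrite andbF/= !mulr0 if_same !adde0 lexx/=.
    by rewrite add0e lee_fin mulr_ge0.
  rewrite /alive_weight Y0 andbT/=.
  have YS : grid_stopped n.+1 w = grid_walk n.+1 w.
    exact: stopped_step.
  have YE : grid_stopped n w = grid_walk n w by exact: stopped_ge0.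
  rewrite YS; case k: (incr n w) => [|[|m]] /=.
  - have W0 : (0 <= grid_walk n.+1 w)%R.
      by rewrite grid_walk_incr0// -YE addr_ge0// ltW// mulr_gt0.
    rewrite W0 ltNge W0/= mulr0 !adde0 -expRD grid_walk_incr0// -YE.
    rewrite (_ : - r * (p * h) + _ = - r * (grid_stopped n w + p * h))%R ?lexx//; ring.
  - rewrite add0e mulr0 adde0 grid_walk_incr1// -YE /overshoot_weight subr_ge0.
    rewrite subr_lt0; case: leP => _ /=; rewrite ?mulr1 ?mulr0 ?adde0 ?add0e lexx//.
  - rewrite !add0e mulr1; case: leP => W0 /=; rewrite ?mulr1 ?mulr0 ?adde0 ?add0e !lee_fin.
      rewrite expR_ge0/= (le_trans _ c_ge1)// -expR0 ler_expR mulNr oppr_le0.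
      by rewrite mulr_ge0// ltW.
    by rewrite c0 lexx.
rewrite -HE -LME; apply/andP; split.
  apply: ge0_le_integral => //.
  - by move=> w _; exact: adde_ge0.
  - exact: emeasurable_funD.
  - by move=> w _; have /andP[] := Hcases w.
apply: (@le_trans _ _ (\int[P]_w (L w + M w + Z w))).
  apply: ge0_le_integral => //.
  - by move=> w _; rewrite adde_ge0// lee_fin alive_weight_ge0.
  - apply: emeasurable_funD => //; exact: emeasurable_funD.
  - by move=> w _; have /andP[] := Hcases w.
rewrite [X in X <= _]ge0_integralD//; first last.
- exact: emeasurable_funD.
- by move=> w _; exact: adde_ge0.
rewrite leeD2l// /Z i1// [X in _ <= X]EFinM lee_wpmul2l ?lee_fin ?(ltW c_gt0)//.
exact: prob_many_claims.
Qed.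

End one_step.

(** * First passage along a path *)

Section first_passage.
Context (R : realType).

Lemma sum_first_passage (X f : nat -> R) (n K : nat) : (K < n)%N ->
  X K.+1 < 0 -> (forall j, (j <= K)%N -> 0 <= X j) ->
  \sum_(k < n) f k * ((0 <= stopped X k) && (stopped X k.+1 < 0))%:R = f K.
Proof.
move=> Kn XK X0.
have K0 : 0 <= stopped X K by exact/stopped_ge0P.
rewrite (bigD1 (Ordinal Kn))// big1 => [|k kK].
  have -> : (nat_of_ord (Ordinal Kn)) = K by [].
  by rewrite stopped_step// K0 XK mulr1 /= addr0.
have [k0|k0] := boolP (0 <= stopped X k); last by rewrite mulr0.
rewrite stopped_step//; case: ltP => Xk; last by rewrite mulr0.
exfalso; case: (ltngtP k K) => [kltK|Kltk|kK'].
- by have := X0 _ kltK; rewrite leNgt Xk.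
- by have /stopped_ge0P/(_ _ Kltk) := k0; rewrite leNgt XK.
- by move/eqP: kK; apply; exact: val_inj.
Qed.

Lemma sum_no_passage (X f : nat -> R) (n : nat) :
  (forall j, (j <= n)%N -> 0 <= X j) ->
  \sum_(k < n) f k * ((0 <= stopped X k) && (stopped X k.+1 < 0))%:R = 0.
Proof.
move=> X0; rewrite big1// => k _.
have [k0|k0] := boolP (0 <= stopped X k); last by rewrite mulr0.
by rewrite stopped_step// ltNge X0 ?mulr0.
Qed.

(** Multiply the k-th relation by delta^k and sum. Since [delta <= 1], an error is never amplified
    and each step costs at most [eps]. The exponent [k.+1] appears because the payment [B k] is made
    at the end of its step. *)
Lemma telescoping_bound (V B : nat -> R) (delta eps : R) (n : nat) :
  0 <= delta <= 1 -> 0 <= eps ->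
  (forall k, V k - eps <= delta * (V k.+1 + B k) <= V k + eps) ->
  V 0 - n%:R * eps <=
    \sum_(k < n) delta ^+ k.+1 * B k + delta ^+ n * V n <=
  V 0 + n%:R * eps.
Proof.
move=> /andP[d0 d1] e0 H; elim: n => [|n /andP[IH1 IH2]].
  by rewrite big_ord0 mul0r subr0 addr0 add0r expr0 mul1r lexx.
rewrite big_ord_recr/= -natr1 mulrDl mul1r.
have /andP[H1 H2] := H n.
have dn0 : 0 <= delta ^+ n by exact: exprn_ge0.
have dn1 : delta ^+ n <= 1 by exact: exprn_ile1.
have de : delta ^+ n * eps <= eps by rewrite ler_piMl.
have G1 := ler_wpM2l dn0 H1; have G2 := ler_wpM2l dn0 H2.
rewrite mulrBr in G1; rewrite mulrDr in G2.
rewrite exprSr -!mulrA -addrA -mulrDr -mulrDr [B n + _]addrC.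
apply/andP; split; lra.
Qed.

Variables (X : R -> R) (q : R).
Hypotheses (X0 : 0 <= X 0) (q_gt0 : 0 < q).
Hypothesis X_rc : forall t, 0 <= t -> X t < 0 -> \forall s \near t^'+, X s < 0.

(** At most one term is nonzero: a first passage at grid index K+1 gives exp(-q h (K+1)). Written as
    a sum, its mean is linear in the passage probabilities. *)
Definition grid_laplace (h : R) (n : nat) : R :=
  \sum_(k < n) expR (- q * h) ^+ k.+1 *
    ((0 <= stopped (fun j => X (h * j%:R)) k) &&
     (stopped (fun j => X (h * j%:R)) k.+1 < 0))%:R.

Let tau : \bar R := ereal_inf [set t%:E | t in [set t : R | 0 <= t /\ X t < 0]].

Lemma ruin_time_ge0 : (0 <= tau)%E.
Proof. by apply: le_ereal_inf_tmp => _ [t [t0 _] <-]; rewrite lee_fin. Qed.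

Lemma grid_laplace_01 (h : R) (n : nat) : 0 <= h ->
  0 <= grid_laplace h n <= 1.
Proof.
move=> h0; pose Xh j := X (h * j%:R).
have [/= exK|nK] := pselect (exists k, (k <= n)%N && (Xh k < 0)).
  case: (ex_minnP exK) => -[|K] /andP[Kn XK] Kmin.
    by move: XK; rewrite /Xh mulr0 ltNge X0.
  rewrite /grid_laplace (@sum_first_passage Xh
    (fun k => expR (- q * h) ^+ k.+1) _ K)//; last first.
    move=> j jK; rewrite leNgt; apply/negP => Xj.
    have := Kmin j; rewrite Xj (leq_trans jK (ltnW Kn)) => /(_ isT).
    by rewrite ltnNge jK.
  rewrite exprn_ge0 ?expR_ge0// exprn_ile1 ?expR_ge0//.
  by rewrite -expR0 ler_expR mulNr oppr_le0 mulr_ge0// ltW.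
rewrite /grid_laplace (@sum_no_passage Xh (fun k => expR (- q * h) ^+ k.+1)) ?lexx ?ler01// => j jn.
by rewrite leNgt; apply/negP => Xj; apply: nK; exists j; rewrite jn.
Qed.

(* The mesh [m.+1 ^- 2] and the number of steps [m.+1 ^ 3] make the horizon
   [m.+1] tend to infinity while [m.+1 ^ 3] errors of order [(m.+1 ^- 2) ^ 2] still
   add up to [o(1)]. *)
Lemma grid_laplace_cvg :
  grid_laplace (m.+1%:R ^- 2) (m.+1 ^ 3)%N @[m --> \oo] -->
  (if (tau < +oo)%E then expR (- q * fine tau) else 0).
Proof.
case: ifPn => [tauy|]; last first.
  move=> tauy.
  have Xge0 t : 0 <= t -> 0 <= X t.
    move=> t0; rewrite leNgt; apply/negP => Xt; move/negP: tauy; apply.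
    apply: (@le_lt_trans _ _ t%:E); last exact: ltry.
    by apply: ereal_inf_lbound; exists t.
  rewrite [X in X @ _ --> _](_ : _ = fun=> 0); first exact: cvg_cst.
  apply/funext => m; apply: (@sum_no_passage (fun j => X (m.+1%:R ^- 2 * j%:R))
    (fun k => expR (- q * m.+1%:R ^- 2) ^+ k.+1)) => j _; apply: Xge0.
  by rewrite mulr_ge0// invr_ge0 exprn_ge0.
have taufin : tau \is a fin_num by rewrite ge0_fin_numE// ruin_time_ge0.
set T := fine tau.
have T0 : 0 <= T by rewrite fine_ge0// ruin_time_ge0.
apply/cvgrPdist_lt => e e0.
(* The map y -> exp(-q y) has Lipschitz constant q on the half-line, so a time error below e / q
   gives an error below e. *)
pose eps := e / q.
have eps0 : 0 < eps by exact: divr_gt0.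
have [t [t0 Xt] tT] : exists2 t, 0 <= t /\ X t < 0 & t < T + eps.
  have : (tau < (T + eps)%:E)%E.
    by rewrite -(fineK taufin) lte_fin ltrDl.
  by move=> /ereal_inf_lt[_ [t tX <-]]; rewrite lte_fin => ?; exists t.
(* The grid may miss a short excursion below 0, but right-continuity keeps X negative on an interval
   starting at [t]; a mesh smaller than this interval cannot skip it. *)
have [dl dl0 Xdl] : exists2 dl, 0 < dl & forall s, t <= s -> s < t + dl -> X s < 0.
  have /nbhs_ballP[dl /= dl0 Bdl] := X_rc t0 Xt.
  exists dl => // s; rewrite le_eqVlt => /predU1P[<-//|ts] std.
  by apply: Bdl => //=; rewrite /ball/= ltr0_norm ?subr_lt0//; lra.
pose d := Num.min dl (T + eps - t).
have d0 : 0 < d by rewrite /d lt_min dl0/=; lra.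
near=> m.
have m1 : (0:R) < m.+1%:R by rewrite ltr0n.
set h := m.+1%:R ^- 2.
have h0 : 0 < h by rewrite invr_gt0 exprn_gt0.
have mT : T + eps <= m.+1%:R.
  near: m; have [M _ HM] := nbhs_infty_ger (T + eps).
  by exists M => // k /= Mk; rewrite (le_trans (HM _ Mk))// ler_nat.
have hd : h < d.
  have : d^-1 < m.+1%:R.
    near: m; have [M _ HM] := nbhs_infty_ger d^-1.
    by exists M => // k /= Mk; rewrite (le_lt_trans (HM _ Mk))// ltr_nat.
  move=> dm; rewrite /h -[d]invrK ltf_pV2 ?posrE ?exprn_gt0 ?invr_gt0//.
  rewrite (lt_le_trans dm)// expr2 ler_peMr// ?ler1n//; exact: ltW.
(* The index [k0.+1] is that of the first grid point strictly after [t], at distance at most [h]. It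
   need not be the first negative one, which is the index [K.+1] obtained below by minimality. *)
pose k0 := Num.truncn (t / h).
have [k1 k2] : t < h * k0.+1%:R /\ h * k0.+1%:R <= t + h.
  have th0 : 0 <= t / h by rewrite divr_ge0// ltW.
  have /andP[H1 H2] := truncn_itv th0; split.
    by rewrite mulrC -ltr_pdivrMr.
  by rewrite -natr1 mulrDr mulr1 lerD2r mulrC -ler_pdivlMr.
have hdl : h < dl by rewrite (lt_le_trans hd)// ge_min lexx.
have hTt : h < T + eps - t by rewrite (lt_le_trans hd)// ge_min lexx orbT.
have Xk0 : X (h * k0.+1%:R) < 0.
  by apply: Xdl; [exact: ltW|rewrite (le_lt_trans k2)// ltrD2l].
have k0T : h * k0.+1%:R < T + eps by rewrite (le_lt_trans k2)//; lra.
have exK : exists k, X (h * k%:R) < 0 by exists k0.+1.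
case: (ex_minnP exK) => -[|K] XK Kmin.
  by move: XK; rewrite mulr0 ltNge X0.
have KT : h * K.+1%:R < T + eps.
  by rewrite (le_lt_trans _ k0T)// ler_pM2l// ler_nat Kmin.
have TK : T <= h * K.+1%:R.
  rewrite -lee_fin fineK//; apply: ereal_inf_lbound; exists (h * K.+1%:R) => //.
  by split => //; rewrite mulr_ge0// ltW.
(* The horizon h (m+1)^3 equals m+1, which exceeds [T + eps], so the passage is seen within the
   allotted steps. *)
have Kn : (K < m.+1 ^ 3)%N.
  rewrite -(ltr_nat R) natrX -(ltr_pM2l h0) (@le_lt_trans _ _ (h * K.+1%:R))//.
    by rewrite ler_pM2l// ler_nat.
  rewrite (lt_le_trans KT)// (le_trans mT)// /h exprS mulrCA.
  by rewrite mulVf ?mulr1// expf_neq0// gt_eqF.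
rewrite /grid_laplace -/h (@sum_first_passage (fun j => X (h * j%:R))
  (fun k => expR (- q * h) ^+ k.+1) _ K)//; last first.
  move=> j jK; rewrite leNgt; apply/negP => /Kmin.
  by rewrite ltnNge jK.
set y := h * K.+1%:R in KT TK *.
rewrite -expRM_natl (_ : K.+1%:R * (- q * h) = - q * T - q * (y - T)); last first.
  by rewrite /y; ring.
rewrite expRD -{1}[expR (- q * T)]mulr1 -mulrBr normrM ger0_norm ?expR_ge0//.
have qT1 : expR (- q * T) <= 1.
  by rewrite -expR0 ler_expR mulNr oppr_le0 mulr_ge0// ltW.
have qy0 : 0 <= q * (y - T) by rewrite mulr_ge0 ?subr_ge0// ltW.
rewrite ger0_norm; last by rewrite subr_ge0 -expR0 ler_expR oppr_le0.
apply: (@le_lt_trans _ _ (q * (y - T))).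
  rewrite -[leRHS]mul1r ler_pM ?expR_ge0//.
    by rewrite subr_ge0 -expR0 ler_expR oppr_le0.
  by have := expR_ge1Dx (- (q * (y - T))); lra.
by rewrite mulrC -ltr_pdivlMr// -/eps; lra.
Unshelve. all: by end_near.
Qed.

End first_passage.

(** * Laplace transform of the ruin time *)

Section laplace_transform.
Context (d : measure_display) (T : measurableType d) (R : realType).
Variable P : probability T R.
Variables (lambda gamma p x : R) (N : R -> {RV P >-> nat}) (S : nat -> {RV P >-> R}).
Hypotheses (p_gt0 : 0 < p) (lambda_gt0 : 0 < lambda) (gamma_gt0 : 0 < gamma).
Hypothesis x_ge0 : 0 <= x.
Hypothesis N_poisson : is_poisson_process lambda N.
Hypothesis S_law : forall (i : nat) (A : set R), measurable A ->
  distribution P (S i) A = exponential_prob gamma A.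
Hypothesis S_indep : mutually_independent P (fun (i : nat) (w : T) => S i w).
Hypothesis NS_indep : independent_sigma P
  (sigma_generated [set s : R | 0 <= s] (fun (s : R) (w : T) => N s w))
  (sigma_generated [set: nat] (fun (i : nat) (w : T) => S i w)).

Local Notation X := (cramer_lundberg x p N S).
Local Notation tau := (ruin_time X).

Lemma cramer_lundberg0 w : X 0 w = x.
Proof.
by rewrite /cramer_lundberg (poisson_process0 N_poisson) big_ord0 mulr0 addr0 subr0.
Qed.

Lemma cramer_lundberg_right_lt0 w t : 0 <= t -> X t w < 0 ->
  \forall s \near t^'+, X s w < 0.
Proof.
move=> t0 Xt.
have Nt : \forall s \near t^'+, N s w = N t w.
  have := poisson_process_right_continuous N_poisson (w := w) t0.
  move=> /(_ [set N t w]); apply.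
  by [].
have Dt : \forall s \near t^'+, p * (s - t) < - X t w.
  near=> s.
  have st : s < t + (- X t w) / p.
    by near: s; apply: nbhs_right_lt; rewrite ltrDl divr_gt0// oppr_gt0.
  rewrite mulrC -ltr_pdivlMr//; lra.
near=> s.
have e1 : N s w = N t w by near: s.
have e2 : p * (s - t) < - X t w by near: s.
move: e2; rewrite /cramer_lundberg e1; lra.
Unshelve. all: by end_near.
Qed.

Definition ruin_laplace (q : R) (w : T) : R :=
  if (tau w < +oo)%E then expR (- q * fine (tau w)) else 0.

Definition grid_ruin_laplace (q h : R) (n : nat) (w : T) : R :=
  grid_laplace (X ^~ w) q h n.

Lemma grid_ruin_laplaceE (q h : R) (n : nat) (w : T) :
  grid_ruin_laplace q h n w =
  \sum_(k < n) expR (- q * h) ^+ k.+1 * \1_(passage p x N S h k) w.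
Proof.
apply: eq_bigr => k _; rewrite indicE; congr (_ * _%:R).
by congr nat_of_bool; apply/idP/idP => [|/set_mem//]; rewrite inE.
Qed.

Lemma grid_ruin_laplace_cvg (q : R) (w : T) : 0 < q ->
  grid_ruin_laplace q (m.+1%:R ^- 2) (m.+1 ^ 3)%N w @[m --> \oo] -->
  ruin_laplace q w.
Proof.
move=> q0; apply: grid_laplace_cvg => //; first by rewrite cramer_lundberg0.
exact: cramer_lundberg_right_lt0.
Qed.

Lemma measurable_grid_ruin_laplace (q h : R) (n : nat) : 0 < h ->
  measurable_fun setT (grid_ruin_laplace q h n).
Proof.
move=> h0; rewrite (funext (grid_ruin_laplaceE q h n)).
apply: measurable_sum => k; apply: measurable_funM => //.
apply: measurable_indic; exact: (measurable_passage p x S N_poisson h0).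
Qed.

Lemma grid_ruin_laplace_01 (q h : R) (n : nat) (w : T) : 0 < q -> 0 < h ->
  0 <= grid_ruin_laplace q h n w <= 1.
Proof.
move=> q0 h0; apply: grid_laplace_01 => //; last exact: ltW.
by rewrite cramer_lundberg0.
Qed.

Lemma integral_grid_ruin_laplace (q h : R) (n : nat) : 0 < h ->
  (\int[P]_w (grid_ruin_laplace q h n w)%:E =
   \sum_(k < n) (expR (- q * h) ^+ k.+1)%:E * P (passage p x N S h k))%E.
Proof.
move=> h0.
have mpass k : measurable (passage p x N S h k).
  exact: (measurable_passage p x S N_poisson h0).
under eq_integral do rewrite grid_ruin_laplaceE -sumEFin.
rewrite ge0_integral_sum//.
- apply: eq_bigr => k _; under eq_integral do rewrite EFinM.
  rewrite ge0_integralZl//.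
  + by rewrite integral_indic// setIT.
  + by apply/measurable_EFinP; exact: measurable_indic.
- move=> k; apply/measurable_EFinP; exact: measurable_funM.
Qed.

(** Measurability passes to the pointwise limit of the grid versions. Taking [q = 1], the event of
    ruin is then the set where this function is positive, and tau is recovered there by a
    logarithm. *)
Lemma measurable_ruin_laplace (q : R) : 0 < q ->
  measurable_fun setT (ruin_laplace q).
Proof.
move=> q0.
apply: (measurable_fun_cvg (h := fun m => grid_ruin_laplace q (m.+1%:R ^- 2) (m.+1 ^ 3)%N)).
  move=> m; apply: measurable_grid_ruin_laplace.
  by rewrite invr_gt0 exprn_gt0.
by move=> w _; exact: grid_ruin_laplace_cvg.
Qed.

Lemma measurable_ruin : measurable [set w | (tau w < +oo)%E].
Proof.
rewrite [X in measurable X](_ : _ = ruin_laplace 1 @^-1` `]0, +oo[); last first.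
  apply/seteqP; split => w /=; rewrite in_itv/= andbT /ruin_laplace.
    by move=> ->; rewrite expR_gt0.
  by case: ifP => //; rewrite ltxx.
by rewrite -[_ @^-1` _]setTI; exact: measurable_ruin_laplace.
Qed.

Lemma ruin_time_fin_num w : (tau w < +oo)%E -> tau w \is a fin_num.
Proof. by move=> wy; rewrite ge0_fin_numE// ruin_time_ge0. Qed.

Lemma measurable_ruin_time_fine :
  measurable_fun [set w | (tau w < +oo)%E] (fun w => fine (tau w)).
Proof.
apply: (eq_measurable_fun (fun w => - ln (ruin_laplace 1 w))).
  by move=> w /set_mem/= wy; rewrite /ruin_laplace wy expRK; ring.
apply: measurable_funTS; apply: measurable_funN.
apply: measurableT_comp => //; exact: measurable_ruin_laplace.
Qed.

Section root.
Variable r : R.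
Hypotheses (r_gt0 : 0 < r) (r_lt : r < gamma).
Let c := gamma / (gamma - r).
Let q := lambda * (c - 1) - p * r.
Hypothesis q_gt0 : 0 < q.

Let gr_gt0 : 0 < gamma - r. Proof. by rewrite subr_gt0. Qed.
Let c_gt0 : 0 < c. Proof. exact: divr_gt0. Qed.
Let c_ge1 : 1 <= c.
Proof. by rewrite /c ler_pdivlMr// mul1r gerBl ltW. Qed.

(** The telescoped one-step relation, with the mean surviving weight as [V] and [c] times the
    passage probability as [B]. The weight left at the end lies between 0 and its discount, hence
    the extra term on the left only. *)
Lemma grid_ruin_laplace_bound (h : R) (n : nat) : 0 < h ->
  expR (- r * x) - n%:R * (c * (lambda * h)) ^+ 2 - expR (- q * h) ^+ n <=
  c * fine (\int[P]_w (grid_ruin_laplace q h n w)%:E)%E <=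
  expR (- r * x) + n%:R * (c * (lambda * h)) ^+ 2.
Proof.
move=> h0; set u := lambda * h; have u0 : 0 < u by exact: mulr_gt0.
(* This dominates both errors: the defect 1 - exp(-c u) (1 + c u), and c u^2 from several claims,
   the latter because c >= 1. *)
set eps := (c * u) ^+ 2.
pose V k := fine (\int[P]_w (alive_weight p x N S h r k w)%:E)%E.
pose b k := fine (P (passage p x N S h k)).
have mA k : measurable_fun setT (alive_weight p x N S h r k).
  exact: (measurable_alive_weight p x S N_poisson h0).
have A01 k w : 0 <= alive_weight p x N S h r k w <= 1.
  by rewrite alive_weight_ge0 alive_weight_le1.
have V01 k : (0 <= \int[P]_w (alive_weight p x N S h r k w)%:E <= 1)%E.
  apply/andP; split.
    by apply: integral_ge0 => w _; rewrite lee_fin; have /andP[] := A01 k w.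
  apply: (@le_trans _ _ (\int[P]_w 1)%E).
    apply: ge0_le_integral => //.
    - by move=> w _; rewrite lee_fin; have /andP[] := A01 k w.
    - exact/measurable_EFinP.
    - by move=> w _; rewrite lee_fin; have /andP[] := A01 k w.
  by rewrite integral_cst// mul1e (probability_le1 P measurableT).
have VE k : (\int[P]_w (alive_weight p x N S h r k w)%:E = (V k)%:E)%E.
  have /andP[V0 V1] := V01 k.
  by rewrite fineK// ge0_fin_numE// (le_lt_trans V1)// ltry.
have V0le k : 0 <= V k by have /andP[+ _] := V01 k; rewrite VE lee_fin.
have V1le k : V k <= 1 by have /andP[_] := V01 k; rewrite VE lee_fin.
have mpass k : measurable (passage p x N S h k).
  exact: (measurable_passage p x S N_poisson h0).
have bE k : P (passage p x N S h k) = (b k)%:E.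
  by rewrite fineK//; exact: fin_num_measure.
have V0 : V 0 = expR (- r * x).
  apply: EFin_inj; rewrite -VE.
  rewrite (eq_integral (fun=> (expR (- r * x))%:E)); last first.
    move=> w _; rewrite /alive_weight /grid_stopped/= /grid_walk mulr0.
    by rewrite cramer_lundberg0 x_ge0.
  rewrite integral_cst// [X in (_ * X)%E](_ : _ = 1%E) ?mule1//.
  exact: probability_setT.
set delta := expR (- q * h).
have d01 : 0 <= delta <= 1.
  by rewrite expR_ge0 -expR0 ler_expR mulNr oppr_le0 mulr_ge0// ltW.
have step k : V k - eps <= delta * (V k.+1 + c * b k) <= V k + eps.
  have := one_step x p_gt0 lambda_gt0 gamma_gt0 N_poisson S_law S_indep NS_indep
     h0 r_gt0 r_lt k erefl.
  rewrite !VE bE -/c -/u -!EFinM -!EFinD !lee_fin.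
  set a := (_ * (1 + c * u)).
  (* The choice of [q] enters here: the exponents -u, -r p h and -q h add up to -c u. *)
  have da : delta * a = expR (- (c * u)) * (1 + c * u).
    rewrite /a /poisson_pmf u0 fact0 expr0 invr1 !mul1r !mulrA /delta -!expRD.
    by congr (expR _ * _); rewrite /q /u; ring.
  move=> /andP[H1 H2].
  have /andP[d0 d1] := d01.
  have {}H1 := ler_wpM2l d0 H1; have {}H2 := ler_wpM2l d0 H2.
  rewrite [delta * (a * _)]mulrA da in H1.
  rewrite [delta * (a * _ + _)]mulrDr [delta * (a * _)]mulrA da in H2.
  have cu0 : 0 <= c * u by rewrite mulr_ge0// ltW.
  have E1 : expR (- (c * u)) * (1 + c * u) <= 1.
    by rewrite expRN mulrC ler_pdivrMr ?expR_gt0// mul1r expR_ge1Dx.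
  have E2 : 1 - eps <= expR (- (c * u)) * (1 + c * u).
    have H := expR_ge1Dx (- (c * u)).
    have : 0 <= (expR (- (c * u)) - (1 - c * u)) * (1 + c * u).
      by rewrite mulr_ge0//; lra.
    by rewrite /eps; lra.
  have E3 : delta * (c * u ^+ 2) <= eps.
    rewrite (@le_trans _ _ (c * u ^+ 2))//.
      by rewrite ler_piMl// mulr_ge0 ?sqr_ge0// ltW.
    by rewrite /eps [(c * u) ^+ 2]exprMn ler_wpM2r ?sqr_ge0// expr2 ler_peMr// ltW.
  have eps0 : 0 <= eps by exact: sqr_ge0.
  have G1 := ler_wpM2r (V0le k) E1; have G2 := ler_wpM2r (V0le k) E2.
  rewrite mulrBl !mul1r in G2; rewrite mul1r in G1.
  have G3 : eps * V k <= eps by rewrite ler_piMr.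
  apply/andP; split; lra.
have := telescoping_bound n d01 (sqr_ge0 (c * u)) step.
rewrite -/eps V0.
have -> : \sum_(k < n) delta ^+ k.+1 * (c * b k) =
    c * fine (\int[P]_w (grid_ruin_laplace q h n w)%:E)%E.
  rewrite integral_grid_ruin_laplace//.
  under [X in fine X]eq_bigr do rewrite bE -EFinM.
  rewrite sumEFin/= mulr_sumr; apply: eq_bigr => k _; ring.
have /andP[d0 d1] := d01.
have : 0 <= delta ^+ n * V n <= delta ^+ n.
  by rewrite mulr_ge0 ?exprn_ge0//= ler_piMr// exprn_ge0.
move=> /andP[? ?] /andP[? ?]; apply/andP; split; lra.
Qed.

Lemma integral_ruin_laplace :
  (\int[P]_w (ruin_laplace q w)%:E = ((1 - r / gamma) * expR (- r * x))%:E)%E.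
Proof.
pose D m := grid_ruin_laplace q (m.+1%:R ^- 2) (m.+1 ^ 3)%N.
have h0 m : (0 : R) < m.+1%:R ^- 2 by rewrite invr_gt0 exprn_gt0.
have mD m : measurable_fun setT (fun w => (D m w)%:E).
  by apply/measurable_EFinP; exact: measurable_grid_ruin_laplace.
have mL : measurable_fun setT (fun w => (ruin_laplace q w)%:E).
  by apply/measurable_EFinP; exact: measurable_ruin_laplace.
have D01 m w : 0 <= D m w <= 1 by exact: grid_ruin_laplace_01.
have int1 : P.-integrable setT (fun=> 1%E).
  apply/integrableP; split => //; under eq_integral do rewrite abse1.
  by rewrite integral_cst// mul1e (le_lt_trans (probability_le1 P measurableT)) ?ltry.
have DL : (\int[P]_w (D m w)%:E @[m --> \oo] --> \int[P]_w (ruin_laplace q w)%:E)%E.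
  have [] := @dominated_convergence _ _ _ P setT measurableT
    (fun m w => (D m w)%:E) (fun w => (ruin_laplace q w)%:E) (fun=> 1%E) mD mL _ int1 _ => //.
  - apply: aeW => w _; apply: cvg_EFin; first exact: nearW.
    exact: grid_ruin_laplace_cvg.
  - apply: aeW => w n _; have /andP[D0 D1] := D01 n w.
    by rewrite lee_fin ger0_norm.
have L01 w : 0 <= ruin_laplace q w <= 1.
  rewrite /ruin_laplace; case: ifP => _; last by rewrite lexx ler01.
  rewrite expR_ge0 -expR0 ler_expR mulNr oppr_le0 mulr_ge0 ?(ltW q_gt0)//.
  by rewrite fine_ge0// ruin_time_ge0.
have Lfin : (\int[P]_w (ruin_laplace q w)%:E)%E \is a fin_num.
  rewrite ge0_fin_numE; last first.
    by apply: integral_ge0 => w _; rewrite lee_fin; have /andP[] := L01 w.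
  apply: (@le_lt_trans _ _ (\int[P]_w 1)%E).
    apply: ge0_le_integral => //.
    - by move=> w _; rewrite lee_fin; have /andP[] := L01 w.
    - by move=> w _; rewrite lee_fin; have /andP[] := L01 w.
  by rewrite integral_cst// mul1e (le_lt_trans (probability_le1 P measurableT)) ?ltry.
rewrite -(fineK Lfin) in DL *; congr (_%:E).
have {}DL : c * fine (\int[P]_w (D m w)%:E)%E @[m --> \oo] -->
    c * fine (\int[P]_w (ruin_laplace q w)%:E)%E.
  by apply: cvgM; [exact: cvg_cst|exact: fine_cvg DL].
suff DL' : c * fine (\int[P]_w (D m w)%:E)%E @[m --> \oo] --> expR (- r * x).
  have := cvg_unique (@Rhausdorff R) DL DL'.
  move=> cL; apply: (mulfI (lt0r_neq0 c_gt0)); rewrite cL mulrA.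
  by rewrite /c; field; rewrite !gt_eqF.
pose K := (c * lambda) ^+ 2.
(* (m+1)^3 steps with errors of order (m+1)^-4 leave K / (m+1). *)
have H n : K * (harmonic n) = (n.+1 ^ 3)%:R * (c * (lambda * n.+1%:R ^- 2)) ^+ 2.
  have : n.+1%:R != 0 :> R by rewrite pnatr_eq0.
  by rewrite /K /harmonic/= natrX; move: n.+1%:R => a a0; field.
have cvK : K * harmonic m @[m --> \oo] --> (0 : R).
  by rewrite -[X in _ --> X](mulr0 K); apply: cvgM; [exact: cvg_cst|exact: cvg_harmonic].
have cvE : q^-1 * harmonic m @[m --> \oo] --> (0 : R).
  by rewrite -[X in _ --> X](mulr0 q^-1); apply: cvgM; [exact: cvg_cst|exact: cvg_harmonic].
apply: (@squeeze_cvgr _ _ _ _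
  (fun m => expR (- r * x) - K * harmonic m - q^-1 * harmonic m)
  (fun m => expR (- r * x) + K * harmonic m)).
- apply: nearW => m.
  have /andP[B1 B2] := grid_ruin_laplace_bound (m.+1 ^ 3) (h0 m).
  rewrite -H in B1 B2; apply/andP; split => //.
  apply: le_trans B1; rewrite lerB//.
  rewrite -expRM_natl.
  (* The surviving discount at the horizon is exp(-q (m+1)), at most 1 / (q (m+1)) because exp y >=
     y. *)
  have -> : (m.+1 ^ 3)%:R * (- q * m.+1%:R ^- 2) = - (q * m.+1%:R) :> R.
    have : m.+1%:R != 0 :> R by rewrite pnatr_eq0.
    by rewrite natrX; move: m.+1%:R => a a0; field.
  rewrite expRN /harmonic -invfM lef_pV2 ?posrE ?expR_gt0 ?mulr_gt0//.
  by apply: le_trans (expR_ge1Dx _); rewrite lerDr.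
- rewrite -[X in _ --> X]subr0 -[X in _ --> X - _]subr0.
  by apply: cvgB => //; apply: cvgB => //; exact: cvg_cst.
- rewrite -[X in _ --> X]addr0.
  by apply: cvgD => //; exact: cvg_cst.
Qed.

End root.

End laplace_transform.

(** * Moments from a Laplace transform *)

Section expR_taylor.
Context (R : realType).
Implicit Types y : R.

Let nonneg_of_derive (f df : R -> R) : f 0 = 0 ->
  (forall y, is_derive y 1 f (df y)) -> (forall y, 0 <= y -> 0 <= df y) ->
  forall y, 0 <= y -> 0 <= f y.
Proof.
move=> f0 fdf df0 y y0; rewrite -f0.
apply: (@ger0_derive1_ndecry R f 0) => //.
- move=> z; rewrite in_itv/= andbT => /ltW z0.
  by rewrite derive1E derive_val; exact: df0.
- apply: continuous_subspaceT => z; apply: differentiable_continuous.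
  by apply/derivable1_diffP; exact: ex_derive.
Qed.

Lemma expRN_le2 y : 0 <= y -> expR (- y) <= 1 - y + y ^+ 2 / 2.
Proof.
move=> y0; rewrite -subr_ge0.
pose f z : R := 1 - z + z ^+ 2 / 2 - expR (- z).
pose df z : R := - 1 + z + expR (- z).
apply: (@nonneg_of_derive f df) => //; rewrite /f /df.
- by rewrite oppr0 expR0; ring.
- move=> z; apply: is_derive_eq.
  by rewrite /GRing.scale/=; field.
- by move=> z z0; have := expR_ge1Dx (- z); lra.
Qed.

Lemma expRN_ge3 y : 0 <= y -> 1 - y + y ^+ 2 / 2 - y ^+ 3 / 6 <= expR (- y).
Proof.
move=> y0; rewrite -subr_ge0.
pose f z : R := expR (- z) - (1 - z + z ^+ 2 / 2 - z ^+ 3 / 6).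
pose df z : R := 1 - z + z ^+ 2 / 2 - expR (- z).
apply: (@nonneg_of_derive f df) => //; rewrite /f /df.
- by rewrite oppr0 expR0; ring.
- move=> z; apply: is_derive_eq.
  by rewrite /GRing.scale/=; field.
- by move=> z z0; rewrite subr_ge0 expRN_le2.
Qed.

(** The second- and third-order bounds pinch the quotient. It serves twice: for the dependence on
    the initial capital and, path by path, for the ruin time. *)
Lemma expRN_taylor2_cvg (rho : R^nat) y : 0 <= y -> (forall n, 0 < rho n) ->
  rho n @[n --> \oo] --> (0 : R) ->
  (expR (- (rho n * y)) - 1 + rho n * y) / rho n ^+ 2 @[n --> \oo] --> y ^+ 2 / 2.
Proof.
move=> y0 rho0 rhoc.
apply: (@squeeze_cvgr _ _ _ _ (fun n => y ^+ 2 / 2 - rho n * (y ^+ 3 / 6))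
  (fun=> y ^+ 2 / 2)).
- apply: nearW => n; have ry : 0 <= rho n * y by rewrite mulr_ge0// ltW.
  have := expRN_le2 ry; have := expRN_ge3 ry; move=> H1 H2.
  rewrite ler_pdivlMr ?exprn_gt0// ler_pdivrMr ?exprn_gt0//.
  move: H1 H2; rewrite !exprMn; move: (expR _) => e H1 H2.
  apply/andP; split; lra.
- rewrite -[X in _ --> X]subr0 -[X in _ --> _ - X](mul0r (y ^+ 3 / 6)).
  by apply: cvgB; [exact: cvg_cst|apply: cvgM => //; exact: cvg_cst].
- exact: cvg_cst.
Qed.

End expR_taylor.

Section moments.
Context (d : measure_display) (T : measurableType d) (R : realType).
Variable P : probability T R.
Local Open Scope ereal_scope.

(* Fatou's lemma gives one inequality and the domination by the limit itself the
   other; the integrability of [g] is a consequence, not an assumption. *)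
Lemma cvg_integral_below (D : set T) (f : (T -> \bar R)^nat) (g : T -> \bar R) l :
  measurable D -> (forall n, measurable_fun D (f n)) -> measurable_fun D g ->
  (forall n w, D w -> 0 <= f n w <= g w) ->
  (forall w, D w -> f n w @[n --> \oo] --> g w) ->
  \int[P]_(w in D) f n w @[n --> \oo] --> l ->
  \int[P]_(w in D) g w = l.
Proof.
move=> mD mf mg fg fcvg fl; apply/eqP; rewrite eq_le; apply/andP; split.
  rewrite -(cvg_lim (@ereal_hausdorff R) fl) -is_cvg_limn_einfE; last by apply/cvg_ex; exists l.
  rewrite (eq_integral (fun w => limn_einf (f ^~ w))); last first.
    move=> w /set_mem Dw; rewrite is_cvg_limn_einfE.
      by apply/esym/cvg_lim => //; exact: fcvg.
    by apply/cvg_ex; exists (g w); exact: fcvg.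
  by apply: fatou => // n w /fg-/(_ n)/andP[].
rewrite -(cvg_lim (@ereal_hausdorff R) fl); apply: lime_le.
  by apply/cvg_ex; exists l.
apply: nearW => n; apply: ge0_le_integral => //.
- by move=> w /fg-/(_ n)/andP[].
- by move=> w /fg-/(_ n)/andP[].
Qed.

(** Only the integrals of [u] and of the sum have to be known and finite; the integrability of [v]
    is not presupposed. *)
Lemma ge0_integral_diff (D : set T) (u v : T -> R) (a b : R) :
  measurable D -> measurable_fun D u -> measurable_fun D v ->
  (forall w, D w -> 0 <= u w)%R -> (forall w, D w -> 0 <= v w)%R ->
  \int[P]_(w in D) (u w)%:E = a%:E ->
  \int[P]_(w in D) (u w + v w)%:E = b%:E ->
  \int[P]_(w in D) (v w)%:E = (b - a)%:E.
Proof.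
move=> mD mu mv u0 v0 ua.
under eq_integral do rewrite EFinD.
rewrite ge0_integralD//.
- rewrite ua => vb; rewrite EFinB -vb addeAC subee// add0e//.
- exact/measurable_EFinP.
- exact/measurable_EFinP.
Qed.

End moments.

(** * Total mass and first two moments from the transform near 0 *)

Section moments_of_laplace.
Context (d : measure_display) (T : measurableType d) (R : realType).
Variable P : probability T R.
Variables (A : set T) (t : T -> R) (g D p x P0 : R).
Hypotheses (mA : measurable A) (mt : measurable_fun A t).
Hypothesis t_ge0 : forall w, A w -> 0 <= t w.
Hypotheses (g_gt0 : 0 < g) (D_gt0 : 0 < D) (p_gt0 : 0 < p) (x_ge0 : 0 <= x).
(** The discount rate as a function of the displacement [rho] of the root from its limit; it is
    positive on (0, [g]) and equivalent to rho D / g at 0. *)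
Let q rho := rho * ((D + p * rho) / (g - rho)).
Hypothesis laplace : forall rho, 0 < rho -> rho < g ->
  (\int[P]_(w in A) (expR (- q rho * t w))%:E =
   (P0 * ((1 - rho / g) * expR (- (rho * x))))%:E)%E.

Let rho n : R := g / 2 * harmonic n.
Let rho_gt0 n : 0 < rho n.
Proof. by rewrite /rho mulr_gt0 ?divr_gt0// /harmonic/= invr_gt0. Qed.
Let rho_lt n : rho n < g.
Proof.
apply: (@le_lt_trans _ _ (g / 2)); last by have := g_gt0; lra.
rewrite /rho ler_piMr//; last by rewrite /harmonic/= invf_le1// ler1n.
by rewrite divr_ge0// ltW.
Qed.
Let cvg_rho : rho n @[n --> \oo] --> (0 : R).
Proof.
by rewrite -[X in _ --> X](mulr0 (g / 2)); apply: cvgM; [exact: cvg_cst|exact: cvg_harmonic].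
Qed.

Let s n := (D + p * rho n) / (g - rho n).
Let s_gt0 n : 0 < s n.
Proof. by rewrite divr_gt0 ?subr_gt0// addr_gt0// mulr_gt0. Qed.
Let q_gt0 n : 0 < q (rho n). Proof. by rewrite mulr_gt0//; exact: s_gt0. Qed.

Let cvg_gB : g - rho n @[n --> \oo] --> g.
Proof. by rewrite -[X in _ --> X]subr0; apply: cvgB => //; exact: cvg_cst. Qed.

Let cvg_s : s n @[n --> \oo] --> D / g.
Proof.
apply: cvgM; last by apply: cvgV => //; rewrite gt_eqF.
rewrite -[X in _ --> X]addr0 -[X in _ --> _ + X](mulr0 p).
by apply: cvgD; [exact: cvg_cst|apply: cvgM => //; exact: cvg_cst].
Qed.

Let cvg_q : q (rho n) @[n --> \oo] --> (0 : R).
Proof. by rewrite -[X in _ --> X](mul0r (D / g)); exact: cvgM. Qed.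

Let e2 n := (expR (- (rho n * x)) - 1 + rho n * x) / rho n ^+ 2.
Let cvg_e2 : e2 n @[n --> \oo] --> x ^+ 2 / 2.
Proof. exact: expRN_taylor2_cvg. Qed.

(** The remainder is kept as an exact factor [e2 n], so that the powers of rho cancel as algebraic
    identities before any limit is taken. *)
Let expR_rho n : expR (- (rho n * x)) = 1 - rho n * x + rho n ^+ 2 * e2 n.
Proof.
rewrite /e2; move: (expR _) => E.
by field; rewrite gt_eqF.
Qed.

Let me : forall n, measurable_fun A (fun w => expR (- q (rho n) * t w)).
Proof. by move=> n; apply: measurableT_comp => //; exact: measurable_funM. Qed.

Let Phi n := P0 * ((1 - rho n / g) * expR (- (rho n * x))).

Let cvg_Phi : Phi n @[n --> \oo] --> P0.
Proof.
rewrite -[X in _ --> X]mulr1 /Phi; apply: cvgM; first exact: cvg_cst.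
rewrite -[X in _ --> X]mulr1; apply: cvgM.
  rewrite -[X in _ --> X]subr0 -[X in _ --> _ - X](mul0r g^-1).
  by apply: cvgB; [exact: cvg_cst|apply: cvgM => //; exact: cvg_cst].
rewrite (funext expR_rho).
rewrite -[X in _ --> X]addr0 -[X in _ --> X + _]subr0; apply: cvgD.
  rewrite -[X in _ --> _ - X](mul0r x).
  by apply: cvgB; [exact: cvg_cst|apply: cvgM => //; exact: cvg_cst].
rewrite -[X in _ --> X](mul0r (x ^+ 2 / 2)); apply: cvgM => //.
by rewrite -[X in _ --> X](mul0r 0); exact: cvgM.
Qed.

Let qt_ge0 n w : A w -> 0 <= q (rho n) * t w.
Proof. by move=> Aw; rewrite mulr_ge0 ?t_ge0// ltW. Qed.

Let cvg_expqt w : A w -> expR (- q (rho n) * t w) @[n --> \oo] --> (1 : R).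
Proof.
move=> Aw; rewrite -[X in _ --> X]expR0.
apply: (@continuous_cvg _ _ _ _ _ _ expR); first exact: continuous_expR.
rewrite -[X in _ --> X](mul0r (t w)); apply: cvgM; last exact: cvg_cst.
by rewrite -[X in _ --> X]oppr0; exact: cvgN.
Qed.

Lemma prob_of_laplace : P A = P0%:E.
Proof.
have <- : (\int[P]_(w in A) 1 = P A)%E by rewrite integral_cst// mul1e.
apply: (cvg_integral_below (f := fun n w => (expR (- q (rho n) * t w))%:E)) => //.
- by move=> n; exact/measurable_EFinP.
- move=> n w Aw; rewrite !lee_fin expR_ge0/= -expR0 ler_expR mulNr oppr_le0.
  exact: qt_ge0.
- by move=> w Aw; apply: cvg_EFin; [exact: nearW|exact: cvg_expqt].
- rewrite (funext (fun n => laplace (rho_gt0 n) (rho_lt n))).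
  by apply: cvg_EFin; [exact: nearW|exact: cvg_Phi].
Qed.

(** Normalised first- and second-order remainders of exp(-q t). They converge to t and t^2 while
    staying below them, by exp(-y) >= 1 - y and [expRN_le2], so [cvg_integral_below] applies. *)
Let f1 n w := (1 - expR (- q (rho n) * t w)) / q (rho n).
Let f2 n w := 2 * ((expR (- (q (rho n) * t w)) - 1 + q (rho n) * t w) / q (rho n) ^+ 2).

Let cvg_f2 w : A w -> f2 n w @[n --> \oo] --> t w ^+ 2.
Proof.
move=> Aw; rewrite (_ : t w ^+ 2 = 2 * (t w ^+ 2 / 2)); last by field.
apply: cvgM; first exact: cvg_cst.
apply: (expRN_taylor2_cvg (rho := fun n => q (rho n))) => //; exact: t_ge0.
Qed.

Let cvg_f1 w : A w -> f1 n w @[n --> \oo] --> t w.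
Proof.
move=> Aw.
have -> : (fun n => f1 n w) = (fun n => t w - q (rho n) * (f2 n w / 2)).
  apply/funext => n; rewrite /f1 /f2 mulNr; move: (expR _) => E.
  by field; rewrite gt_eqF.
rewrite -[X in _ --> X]subr0; apply: cvgB; first exact: cvg_cst.
rewrite -[X in _ --> X](mul0r (t w ^+ 2 / 2)); apply: cvgM => //.
by apply: cvgM; [exact: cvg_f2|exact: cvg_cst].
Qed.

Let f1_ge0 n w : A w -> 0 <= f1 n w.
Proof.
move=> Aw; rewrite divr_ge0 ?(ltW (q_gt0 n))// subr_ge0 -expR0 ler_expR mulNr oppr_le0.
exact: qt_ge0.
Qed.

Let f1_le n w : A w -> f1 n w <= t w.
Proof.
move=> Aw; rewrite ler_pdivrMr// mulNr.
have := expR_ge1Dx (- (q (rho n) * t w)); lra.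
Qed.

Let f2_ge0 n w : A w -> 0 <= f2 n w.
Proof.
move=> Aw; rewrite mulr_ge0// divr_ge0// ?sqr_ge0//.
have := expR_ge1Dx (- (q (rho n) * t w)); lra.
Qed.

Let f2_le n w : A w -> f2 n w <= t w ^+ 2.
Proof.
move=> Aw; rewrite /f2 mulrA ler_pdivrMr ?exprn_gt0//.
have := expRN_le2 (qt_ge0 n Aw); rewrite exprMn; lra.
Qed.

Let mf1 n : measurable_fun A (f1 n).
Proof. by apply: measurable_funM => //; exact: measurable_funB. Qed.

Let mf2 n : measurable_fun A (f2 n).
Proof.
apply: measurable_funM => //; apply: measurable_funM => //.
apply: measurable_funD; last exact: measurable_funM.
apply: measurable_funB => //.
by under eq_fun do rewrite -mulNr; exact: me.
Qed.

Lemma mean_of_laplace :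
  (\int[P]_(w in A) (t w)%:E = (P0 * ((g * x + 1) / D))%:E)%E.
Proof.
apply: (cvg_integral_below (f := fun n w => (f1 n w)%:E)) => //.
- by move=> n; exact/measurable_EFinP.
- exact/measurable_EFinP.
- by move=> n w Aw; rewrite !lee_fin f1_ge0//= f1_le.
- by move=> w Aw; apply: cvg_EFin; [exact: nearW|exact: cvg_f1].
(* The integral is [(P0 - Phi n) / q (rho n)]. The zeroth-order terms cancel and the remaining
   factor [rho n] is removed against that of [q], since [q (rho n) = rho n * s n]. *)
have If1 n : (\int[P]_(w in A) (f1 n w)%:E = (P0 * ((x - rho n * e2 n +
    g^-1 * (1 - rho n * x + rho n ^+ 2 * e2 n)) / s n))%:E)%E.
  have qn0 : (0 <= (q (rho n))%:E)%E by rewrite lee_fin ltW.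
  have H : (\int[P]_(w in A) (q (rho n) * f1 n w)%:E = (P0 - Phi n)%:E)%E.
    apply: (ge0_integral_diff (u := fun w => expR (- q (rho n) * t w))) => //.
    - exact: measurable_funM.
    - by move=> w Aw; rewrite mulr_ge0 ?f1_ge0// ltW.
    - exact: laplace.
    - rewrite -prob_of_laplace -[RHS]mul1e -integral_cst//.
      apply: eq_integral => w _; congr (_%:E); rewrite /f1.
      by field; rewrite gt_eqF.
  have -> : (\int[P]_(w in A) (f1 n w)%:E =
      ((q (rho n))^-1)%:E * \int[P]_(w in A) (q (rho n) * f1 n w)%:E)%E.
    rewrite -ge0_integralZl//.
    - by apply: eq_integral => w _; rewrite -EFinM mulKf// gt_eqF.
    - by apply/measurable_EFinP; exact: measurable_funM.
    - by move=> w Aw; rewrite lee_fin mulr_ge0 ?f1_ge0// ltW.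
    - by rewrite lee_fin invr_ge0 ltW.
  rewrite H -EFinM; congr (_%:E); rewrite /Phi expR_rho /q -/(s n).
  move: (s n) (s_gt0 n) (e2 n) (rho n) (rho_gt0 n) => s' s0 e r r0.
  by field; rewrite !gt_eqF.
rewrite (funext If1).
apply: cvg_EFin; first exact: nearW.
apply: cvgM; first exact: cvg_cst.
rewrite (_ : (g * x + 1) / D = (x + g^-1) / (D / g)); last by field; rewrite !gt_eqF.
apply: cvgM; last by apply: cvgV => //; rewrite gt_eqF// divr_gt0.
have cre : rho n * e2 n @[n --> \oo] --> (0 : R).
  by rewrite -[X in _ --> X](mul0r (x ^+ 2 / 2)); exact: cvgM.
have crx : rho n * x @[n --> \oo] --> (0 : R).
  by rewrite -[X in _ --> X](mul0r x); apply: cvgM => //; exact: cvg_cst.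
apply: cvgD.
  by rewrite -[X in _ --> X]subr0; apply: cvgB => //; exact: cvg_cst.
rewrite -[X in _ --> X]mulr1; apply: cvgM; first exact: cvg_cst.
rewrite -[X in _ --> X]addr0 -[X in _ --> X + _]subr0; apply: cvgD.
  by apply: cvgB => //; exact: cvg_cst.
rewrite (_ : (fun n => _) = (fun n => rho n * (rho n * e2 n))); last first.
  by apply/funext => n; rewrite mulrA.
by rewrite -[X in _ --> X](mul0r 0); exact: cvgM.
Qed.

Lemma second_moment_of_laplace :
  (\int[P]_(w in A) (t w ^+ 2)%:E = (P0 * (((g * x) ^+ 2 + 2 * g * x) / D ^+ 2 +
    2 * (g * x + 1) * (D + p * g) / D ^+ 3))%:E)%E.
Proof.
set m1 := (g * x + 1) / D.
apply: (cvg_integral_below (f := fun n w => (f2 n w)%:E)) => //.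
- by move=> n; exact/measurable_EFinP.
- by apply/measurable_EFinP; exact: measurable_funX.
- by move=> n w Aw; rewrite !lee_fin f2_ge0//= f2_le.
- by move=> w Aw; apply: cvg_EFin; [exact: nearW|exact: cvg_f2].
have If2 n : (\int[P]_(w in A) (f2 n w)%:E = (P0 * (2 * (e2 n + x / g - rho n * e2 n / g +
    (g * x + 1) * (D + p * g) / (g * D * (g - rho n))) / s n ^+ 2))%:E)%E.
  have qn0 := q_gt0 n.
  have H : (\int[P]_(w in A) (q (rho n) ^+ 2 / 2 * f2 n w)%:E =
      (Phi n + q (rho n) * (P0 * m1) - P0)%:E)%E.
    apply: (ge0_integral_diff (u := fun=> 1)) => //.
    - exact: measurable_funM.
    - by move=> w Aw; rewrite mulr_ge0 ?f2_ge0// divr_ge0// sqr_ge0.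
    - by rewrite integral_cst// mul1e; exact: prob_of_laplace.
    - rewrite (eq_integral (fun w => (expR (- q (rho n) * t w))%:E + (q (rho n))%:E * (t w)%:E)%E).
        rewrite ge0_integralD//.
        + rewrite laplace// ge0_integralZl//.
          * by rewrite mean_of_laplace -EFinM -EFinD.
          * exact/measurable_EFinP.
          * by rewrite lee_fin ltW.
        + exact/measurable_EFinP.
        + by move=> w Aw; rewrite -EFinM lee_fin qt_ge0.
        + by apply/measurable_EFinP; exact: measurable_funM.
      move=> w _; rewrite -EFinM -EFinD; congr (_%:E); rewrite /f2 mulNr.
      by field; rewrite gt_eqF.
  have -> : (\int[P]_(w in A) (f2 n w)%:E =
      (2 / q (rho n) ^+ 2)%:E * \int[P]_(w in A) (q (rho n) ^+ 2 / 2 * f2 n w)%:E)%E.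
    rewrite -ge0_integralZl//.
    - apply: eq_integral => w _; rewrite -EFinM; congr (_%:E).
      by field; rewrite gt_eqF.
    - by apply/measurable_EFinP; exact: measurable_funM.
    - by move=> w Aw; rewrite lee_fin mulr_ge0 ?f2_ge0// divr_ge0// sqr_ge0.
    - by rewrite lee_fin divr_ge0// sqr_ge0.
  rewrite H -EFinM; congr (_%:E); rewrite /Phi expR_rho /q /s /m1.
  have gr : g - rho n != 0 by rewrite subr_eq0 gt_eqF.
  have Dr : D + p * rho n != 0 by rewrite gt_eqF// addr_gt0// mulr_gt0.
  move: (e2 n) (rho n) (rho_gt0 n) gr Dr => e r r0 gr Dr.
  set K := (g * x + 1) * (D + p * g) / _; set s1 := _ / (g - r).
  have s10 : s1 != 0 by rewrite mulf_neq0 ?invr_eq0.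
  (* Expands q times the mean to second order in rho, with exact coefficient [K]; its first-order
     part x + 1/g cancels that of [Phi], so division by q^2 leaves a finite limit. *)
  have -> : r * s1 * (P0 * ((g * x + 1) / D)) = r * (P0 * (x + g^-1 + r * K)).
    have -> : x + g^-1 + r * K = s1 * ((g * x + 1) / D).
      by rewrite /K /s1; field; rewrite gr !gt_eqF.
    by move: (_ / D) s1 {s10} => X0 s1; ring.
  move: K s1 s10 => K s1 s10.
  by field; rewrite s10 !gt_eqF.
rewrite (funext If2).
apply: cvg_EFin; first exact: nearW.
apply: cvgM; first exact: cvg_cst.
rewrite [X in _ --> X](_ : _ = 2 * (x ^+ 2 / 2 + x / g - 0 / g +
  (g * x + 1) * (D + p * g) / (g * D * g)) /
  (D / g) ^+ 2); last by field; rewrite !gt_eqF.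
apply: cvgM; last first.
  apply: cvgV; first by rewrite expf_neq0// gt_eqF// divr_gt0.
  exact: cvgM.
apply: cvgM; first exact: cvg_cst.
apply: cvgD.
  apply: cvgB.
    by apply: cvgD => //; exact: cvg_cst.
  apply: cvgM; last exact: cvg_cst.
  by rewrite -[X in _ --> X](mul0r (x ^+ 2 / 2)); exact: cvgM.
apply: cvgM; first exact: cvg_cst.
apply: cvgV; first by rewrite gt_eqF// !mulr_gt0.
by apply: cvgM => //; exact: cvg_cst.
Qed.

End moments_of_laplace.

(** * The Laplace exponent *)

Section laplace_exponent.
Context (d : measure_display) (T : measurableType d) (R : realType).
Variable P : probability T R.
Variables (lambda gamma p : R) (N : R -> {RV P >-> nat}) (S : nat -> {RV P >-> R}).
Hypotheses (lambda_gt0 : 0 < lambda) (gamma_gt0 : 0 < gamma).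
Hypothesis N_poisson : is_poisson_process lambda N.
Hypothesis S_law : forall (i : nat) (A : set R), measurable A ->
  distribution P (S i) A = exponential_prob gamma A.
Hypothesis S_indep : mutually_independent P (fun (i : nat) (w : T) => S i w).
Hypothesis NS_indep : independent_sigma P
  (sigma_generated [set s : R | 0 <= s] (fun (s : R) (w : T) => N s w))
  (sigma_generated [set: nat] (fun (i : nat) (w : T) => S i w)).
Variable t : R.
Hypothesis t_gt0 : 0 < t.

Let S_eq_law (i j : nat) (A : set R) : measurable A ->
  distribution P (S i) A = distribution P (S j) A.
Proof. by move=> mA; rewrite !S_law. Qed.

Section fixed_theta.
Variable theta : R.
Hypothesis theta_gt0 : 0 < theta.
Let c := gamma / (gamma + theta).
Let c_gt0 : 0 < c. Proof. by rewrite divr_gt0// addr_gt0. Qed.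

(** The value [j] of the count and the number [k] of claims are kept apart so that claims can be
    added one at a time by induction on [k]; only [k = j] is used in the end. *)
Let Z (j k : nat) (w : T) : R :=
  if N t w == j then expR (- theta * \sum_(i < k) S i w) else 0.

(** A grid of mesh [t] with a single step makes [N t] part of the history. *)
Let Z_past (j k : nat) : measurable_fun
  [set: g_sigma_algebraType (past N S t 1 k)]
  (fun w : g_sigma_algebraType (past N S t 1 k) => Z j k w).
Proof.
apply: measurable_fun_ifT => //.
  apply: measurable_fun_eqn => //.
  have := measurable_past_count (S := S) (k := k) N_poisson t_gt0 (leqnn 1).
  by rewrite mulr1.
apply: measurableT_comp => //; apply: measurable_funM => //.
by apply: measurable_sum => i; exact: measurable_past_claim.
Qed.

Let mZ (j k : nat) : measurable_fun setT (Z j k).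
Proof.
move=> _ A mA; rewrite setTI; apply: (@past_measurable _ _ _ _ N S t 1 k).
by rewrite -[_ @^-1` _]setTI; exact: Z_past.
Qed.

Let Z_ge0 (j k : nat) w : 0 <= Z j k w.
Proof. by rewrite /Z; case: ifP => // _; rewrite expR_ge0. Qed.

Local Open Scope ereal_scope.

Lemma integral_count_claims (j k : nat) :
  \int[P]_w (Z j k w)%:E = P (N t @^-1` [set j]) * (c ^+ k)%:E.
Proof.
have mNj : measurable (N t @^-1` [set j]).
  by rewrite -[_ @^-1` _]setTI; exact: measurable_funP.
elim: k => [|k IH].
  rewrite expr0 mule1.
  rewrite (eq_integral (fun w => (\1_(N t @^-1` [set j]) w)%:E)); last first.
    move=> w _; rewrite /Z big_ord0 mulr0 expR0 indicE.
    have -> : (w \in N t @^-1` [set j]) = (N t w == j).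
      by apply/idP/eqP => [/set_mem//|]; rewrite inE.
    by case: eqP.
  by rewrite integral_indic// setIT.
pose ZR : {RV P >-> R} := mfun_Sub (mem_set (mZ j k)).
(* The absolute value makes [f] nonnegative everywhere, as [indep_integral] requires; it is harmless
   because [Z] is nonnegative. *)
pose f (z : (R * R)%type) : \bar R := (`|z.1| * expR (- theta * z.2))%:E.
have mf : measurable_fun [set: (R * R)%type] f.
  apply/measurable_EFinP; apply: measurable_funM; first exact: measurableT_comp.
  by apply: measurableT_comp => //; apply: measurable_funM.
have f0 z : 0 <= f z by rewrite lee_fin mulr_ge0// expR_ge0.
have ind (A B : set R) : measurable A -> measurable B ->
    P (ZR @^-1` A `&` S k @^-1` B) = P (ZR @^-1` A) * P (S k @^-1` B).
  move=> mA mB.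
  have sA : <<s past N S t 1 k >> (ZR @^-1` A).
    by rewrite -[_ @^-1` _]setTI; exact: Z_past.
  have := past_indep N_poisson S_indep NS_indep t_gt0 setT sA mB.
  by rewrite preimage_setT setTI probability_setT mul1e.
transitivity (\int[P]_w f (ZR w, S k w)).
  apply: eq_integral => w _; congr (_%:E); rewrite /= ger0_norm//.
  rewrite /Z; case: ifP => _; last by rewrite mul0r.
  by rewrite big_ord_recr/= mulrDr expRD.
rewrite (indep_integral mf f0 ind).
under eq_integral => w _.
  under eq_integral do rewrite /f/= EFinM.
  rewrite ge0_integralZl//; last first.
    by apply/measurable_EFinP; apply: measurableT_comp => //; exact: measurable_funM.
  rewrite (exponential_laplace (gamma := gamma))// ?addr_gt0//; last exact: S_law.
  rewrite ger0_norm//.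
  over.
rewrite ge0_integralZr//.
- by rewrite IH -muleA -EFinM exprSr.
- exact/measurable_EFinP.
- by move=> w _; rewrite lee_fin Z_ge0.
- by rewrite lee_fin ltW.
Qed.

Let X := cramer_lundberg 0 p N S.

Lemma mmt_cramer_lundberg :
  'M_P (X t) theta = (expR (t * (p * theta - lambda * theta / (theta + gamma))))%:E.
Proof.
rewrite /mmt_gen_fun unlock.
have NE j : P (N t @^-1` [set j]) = (poisson_pmf (lambda * t) j)%:E.
  have -> : N t @^-1` [set j] = [set w | (N t w - N 0%R w)%N = j].
    by apply/seteqP; split => w /=; rewrite (poisson_process0 N_poisson) subn0.
  by rewrite (poisson_process_law N_poisson)// subr0.
have lt0 : (0 < lambda * t)%R by rewrite mulr_gt0.
transitivity (\sum_(j <oo) \int[P]_w ((expR (theta * (p * t)) * Z j j w)%:E)).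
  rewrite -integral_nneseries//.
  - apply: eq_integral => w _.
    have fE j : (expR (theta * (p * t)) * Z j j w)%:E =
        if j == N t w then (expR (theta * X t w))%:E else 0.
      rewrite /Z; have [->|jN] := eqVneq j (N t w); last first.
        by rewrite mulr0.
      rewrite -expRD; congr (expR _)%:E; rewrite /X /cramer_lundberg add0r; ring.
    rewrite (@nneseries_split _ _ 0 (N t w).+1)//; last first.
      by move=> j _; rewrite fE; case: ifP => // _; rewrite lee_fin expR_ge0.
    rewrite add0n big_nat_recr//= fE eqxx big_nat_cond big1 => [|j /andP[/andP[_ jN] _]].
      rewrite eseries0 ?adde0 ?add0e//.
        by rewrite /= mulrC.
      by move=> j Nj _; rewrite fE gtn_eqF.
    by rewrite fE ltn_eqF.
  - move=> j; apply/measurable_EFinP; exact: measurable_funM.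
  - by move=> j w _; rewrite lee_fin mulr_ge0// expR_ge0.
have -> : (t * (p * theta - lambda * theta / (theta + gamma)) =
    theta * (p * t) + lambda * t * (c - 1))%R.
  by rewrite /c; field; rewrite addrC gt_eqF// addr_gt0.
(* Each factor [c ^+ j] is absorbed into a Poisson weight of parameter [lambda * t * c]; these
   weights sum to 1 and the normalisation leaves exp(lambda t (c - 1)). *)
transitivity (\sum_(j <oo) (expR (theta * (p * t) + lambda * t * (c - 1)))%:E *
    (poisson_pmf (lambda * t * c) j)%:E).
  apply: eq_eseriesr => j _.
  under eq_integral do rewrite EFinM.
  rewrite ge0_integralZl//; first last.
  - by move=> w _; rewrite lee_fin Z_ge0.
  - exact/measurable_EFinP.
  rewrite integral_count_claims NE -!EFinM; congr (_%:E).
  rewrite /poisson_pmf lt0 mulr_gt0// expRD [((_ * c) ^+ j)%R]exprMn.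
  have E : (expR (lambda * t * (c - 1)) * expR (- (lambda * t * c)) = expR (- (lambda * t)))%R.
    by rewrite -expRD; congr expR; ring.
  rewrite -E; move: (expR (lambda * t * (c - 1))) (expR (- (lambda * t * c))) => e1 e2.
  ring.
rewrite nneseriesZl//; last by move=> j _; rewrite lee_fin poisson_pmf_ge0.
rewrite (_ : \sum_(_ <oo) _ = 1) ?mule1//.
have ltc : (0 < lambda * t * c)%R by rewrite mulr_gt0.
have := probability_setT (poisson_prob (lambda * t * c) 0).
rewrite /= /poisson_prob ltc -nneseries_esumT//.
by move=> j; rewrite lee_fin poisson_pmf_ge0.
Qed.

Lemma laplace_exponent_cramer_lundberg :
  laplace_exponent P X t theta =
  (p * theta - lambda * theta / (theta + gamma))%R.
Proof.
rewrite /laplace_exponent mmt_cramer_lundberg/= expRK mulrA mulVf ?mul1r//.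
by rewrite gt_eqF.
Qed.

End fixed_theta.

Local Notation psi := (laplace_exponent P (cramer_lundberg 0 p N S) t).

Lemma derive1_laplace_exponent (theta : R) : 0 < theta ->
  psi^`()%classic theta = p - lambda * gamma / (theta + gamma) ^+ 2.
Proof.
move=> th0; rewrite derive1E.
have tg0 : theta + gamma != 0 by rewrite gt_eqF// addr_gt0.
have der : is_derive theta 1 (fun z : R => p * z - lambda * z / (z + gamma))
    (p - lambda * gamma / (theta + gamma) ^+ 2).
  apply: is_derive_eq.
  by rewrite /GRing.scale/=; field.
(* The closed form has been obtained for positive arguments only; differentiation being local, this
   is enough at [theta > 0]. *)
rewrite -(near_eq_derive (f := fun z : R => p * z - lambda * z / (z + gamma))).
  by rewrite derive_val.
near=> z; rewrite laplace_exponent_cramer_lundberg//.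
by near: z; exact: lt_nbhsr.
Unshelve. all: by end_near.
Qed.

Lemma cvg_derive1_laplace_exponent :
  psi^`()%classic theta @[theta --> 0^'+] --> p - lambda / gamma.
Proof.
have : (fun z : R => p - lambda * gamma / (z + gamma) ^+ 2) z @[z --> 0^'+] -->
    p - lambda / gamma.
  rewrite (_ : lambda / gamma = lambda * gamma / (0 + gamma) ^+ 2); last first.
    by rewrite add0r; field; rewrite gt_eqF.
  apply: cvg_at_right_filter.
  apply: cvgB; first exact: cvg_cst.
  apply: cvgM; first exact: cvg_cst.
  apply: cvgV; first by rewrite expf_neq0// add0r gt_eqF.
  by apply: cvgM; apply: cvgD; [exact: cvg_id|exact: cvg_cst|exact: cvg_id|exact: cvg_cst].
apply: cvg_trans; apply: near_eq_cvg; near=> z.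
by rewrite derive1_laplace_exponent.
Unshelve. all: by end_near.
Qed.

End laplace_exponent.

(** * Conditional moments of the ruin time *)

Section conditional_moments.
Context (d : measure_display) (T : measurableType d) (R : realType).
Variable P : probability T R.
Variables (A : set T) (Y : T -> \bar R) (P0 m M2 : R).
Hypotheses (mA : measurable A) (mY : measurable_fun A (fun w => fine (Y w))).
Hypothesis YA : forall w, A w -> Y w \is a fin_num /\ (0 <= Y w)%E.
Hypotheses (P0_gt0 : 0 < P0) (m_ge0 : 0 <= m).
Hypothesis prob : P A = P0%:E.
Hypothesis mean : (\int[P]_(w in A) (fine (Y w))%:E = (P0 * m)%:E)%E.
Hypothesis second : (\int[P]_(w in A) (fine (Y w) ^+ 2)%:E = (P0 * M2)%:E)%E.

Let div_prob (a : R) : ((P0 * a)%:E / P A = a%:E)%E.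
Proof. by rewrite prob inver gt_eqF// -EFinM mulrAC mulfV ?mul1r// gt_eqF. Qed.

Lemma cond_expectation_mean : cond_expectation P A Y = m%:E.
Proof.
rewrite /cond_expectation -(div_prob m) -mean; congr (_ / _)%E.
by apply: eq_integral => w /set_mem/YA[Yw _]; rewrite fineK.
Qed.

Lemma cond_variance_moments : cond_variance P A Y = (M2 - m ^+ 2)%:E.
Proof.
rewrite /cond_variance cond_expectation_mean /cond_expectation.
rewrite -(div_prob (M2 - m ^+ 2)); congr (_ / _)%E.
rewrite (eq_integral (fun w => ((fine (Y w) - m) ^+ 2)%:E)); last first.
  by move=> w /set_mem/YA[Yw _]; rewrite -{1}(fineK Yw) -EFinB EFin_expe.
have Yge0 w : A w -> 0 <= fine (Y w) by move=> /YA[_]; exact: fine_ge0.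
have -> : P0 * (M2 - m ^+ 2) = P0 * M2 + m ^+ 2 * P0 - 2 * m * (P0 * m) by ring.
(* The identity (Y - m)^2 + 2 m Y = Y^2 + m^2 involves nonnegative terms only, so the cross term is
   moved across without integrating a signed function. *)
apply: (ge0_integral_diff (u := fun w => 2 * m * fine (Y w))) => //.
- exact: measurable_funM.
- by apply: measurable_funX; exact: measurable_funB.
- by move=> w Aw; rewrite !mulr_ge0// Yge0.
- by move=> w Aw; exact: sqr_ge0.
- under eq_integral do rewrite EFinM.
  rewrite ge0_integralZl//.
  + by rewrite mean.
  + exact/measurable_EFinP.
  + by rewrite lee_fin mulr_ge0.
- rewrite (eq_integral (fun w => (fine (Y w) ^+ 2)%:E + (m ^+ 2)%:E)%E); last first.
    by move=> w _; rewrite -EFinD; congr (_%:E); ring.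
  rewrite ge0_integralD//.
  + rewrite second integral_cst// [X in (_ + _ * X)%E](_ : _ = P0%:E)//.
  + by move=> w _; rewrite lee_fin sqr_ge0.
  + by apply/measurable_EFinP; exact: measurable_funX.
  + by move=> w _; rewrite lee_fin sqr_ge0.
Qed.

End conditional_moments.

(** * Moments of the ruin time in a form common to both regimes *)

Section ruin_moments.
Context (d : measure_display) (T : measurableType d) (R : realType).
Variable P : probability T R.
Variables (lambda gamma p x : R) (N : R -> {RV P >-> nat}) (S : nat -> {RV P >-> R}).
Hypotheses (p_gt0 : 0 < p) (lambda_gt0 : 0 < lambda) (gamma_gt0 : 0 < gamma).
Hypothesis x_ge0 : 0 <= x.
Hypothesis N_poisson : is_poisson_process lambda N.
Hypothesis S_law : forall (i : nat) (A : set R), measurable A ->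
  distribution P (S i) A = exponential_prob gamma A.
Hypothesis S_indep : mutually_independent P (fun (i : nat) (w : T) => S i w).
Hypothesis NS_indep : independent_sigma P
  (sigma_generated [set s : R | 0 <= s] (fun (s : R) (w : T) => N s w))
  (sigma_generated [set: nat] (fun (i : nat) (w : T) => S i w)).

Local Notation tau := (ruin_time (cramer_lundberg x p N S)).
Local Notation ruin := [set w | (tau w < +oo)%E].

Let laplace_on_ruin (r q : R) : 0 < r -> r < gamma -> 0 < q ->
  q = lambda * (gamma / (gamma - r) - 1) - p * r ->
  (\int[P]_(w in ruin) (expR (- q * fine (tau w)))%:E =
   ((1 - r / gamma) * expR (- r * x))%:E)%E.
Proof.
move=> r0 rg q0 qE.
rewrite -(integral_ruin_laplace p_gt0 lambda_gt0 gamma_gt0 x_ge0 N_poisson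
  S_law S_indep NS_indep r0 rg); last by rewrite -qE.
rewrite [LHS]integral_mkcond; apply: eq_integral => w _.
rewrite patchE /ruin_laplace -qE.
have -> : (w \in ruin) = (tau w < +oo)%E.
  by apply/idP/idP => [/set_mem//|]; rewrite inE.
by case: ifP.
Qed.

(* [g] and [D] stand for [gamma] and [lambda - p * gamma] when ruin is certain
   and for [lambda / p] and [p * gamma - lambda] otherwise, the latter being the
   parameters of the process conditioned on ruin; [R0] is the limit of [r] when [q]
   tends to [0], the adjustment coefficient in the second case. *)
Lemma ruin_cond_moments (g D R0 : R) : 0 < g -> 0 < D -> 0 <= R0 ->
  gamma = R0 + g -> R0 * (lambda - p * g) = 0 -> D = p * R0 + lambda - p * g ->
  cond_expectation P ruin tau = ((g * x + 1) / D)%:E /\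
  cond_variance P ruin tau = (2 * (D + p * g) * g * x / D ^+ 3 + (D + 2 * p * g) / D ^+ 3)%:E.
Proof.
move=> g0 D0 R00 gE R0E DE.
(* This is the ruin probability: g / gamma is 1 - R0 / gamma, the prefactor of the transform at r =
   R0. *)
pose P0 := g / gamma * expR (- R0 * x).
have P00 : 0 < P0 by rewrite mulr_gt0 ?expR_gt0// divr_gt0.
have lapl rho : 0 < rho -> rho < g ->
  (\int[P]_(w in ruin) (expR (- (rho * ((D + p * rho) / (g - rho))) * fine (tau w)))%:E =
   (P0 * ((1 - rho / g) * expR (- (rho * x))))%:E)%E.
  move=> rho0 rhog.
  have grho : 0 < g - rho by rewrite subr_gt0.
  rewrite (laplace_on_ruin (r := R0 + rho)).
  - congr (_%:E); rewrite /P0.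
    rewrite (_ : - (R0 + rho) * x = - R0 * x + - (rho * x)); last by ring.
    rewrite expRD gE; move: (expR _) (expR _) => e1 e2.
    by field; rewrite !gt_eqF// ltr_wpDl.
  - by rewrite ltr_wpDl.
  - by rewrite gE ltrD2l.
  - by rewrite mulr_gt0// divr_gt0// addr_gt0// mulr_gt0.
  - have -> : gamma - (R0 + rho) = g - rho by rewrite gE; ring.
    have -> : D + p * rho = p * R0 + (lambda - p * g) + p * rho by rewrite DE; ring.
    have gr : g - rho != 0 by rewrite gt_eqF.
    (* The hypothesis [R0E] says that q vanishes at r = R0: it cancels the constant term of the
       numerator of q, leaving the factor [rho]. *)
    by rewrite -[LHS]addr0 -(mul0r (g - rho)^-1) -R0E gE; field.
have mR := measurable_ruin S p_gt0 x_ge0 N_poisson.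
have mtau := measurable_ruin_time_fine (S := S) p_gt0 x_ge0 N_poisson.
have tau0 w : ruin w -> 0 <= fine (tau w).
  by move=> _; rewrite fine_ge0// ruin_time_ge0.
have tauP w : ruin w -> tau w \is a fin_num /\ (0 <= tau w)%E.
  by move=> rw; split; [exact: ruin_time_fin_num|exact: ruin_time_ge0].
have prob := prob_of_laplace mR mtau tau0 g0 D0 p_gt0 x_ge0 lapl.
have mean := mean_of_laplace mR mtau tau0 g0 D0 p_gt0 x_ge0 lapl.
have second := second_moment_of_laplace mR mtau tau0 g0 D0 p_gt0 x_ge0 lapl.
have m0 : 0 <= (g * x + 1) / D.
  by rewrite divr_ge0 ?(ltW D0)// addr_ge0// mulr_ge0// ltW.
split; first exact: cond_expectation_mean tauP P00 prob mean.
rewrite (cond_variance_moments mR mtau tauP P00 m0 prob mean second).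
by congr (_%:E); field; rewrite gt_eqF.
Qed.

End ruin_moments.

Theorem corollary5p4 (d : measure_display) (T : measurableType d) (R : realType)
    (P : probability T R) (p lambda gamma : R)
    (N : R -> {RV P >-> nat}) (S : nat -> {RV P >-> R})
    (p_gt0 : 0 < p) (lambda_gt0 : 0 < lambda) (gamma_gt0 : 0 < gamma)
    (N_poisson : is_poisson_process lambda N)
    (S_law : forall (i : nat) (A : set R), measurable A ->
      distribution P (S i) A = exponential_prob gamma A)
    (S_indep : mutually_independent P (fun (i : nat) (w : T) => S i w))
    (NS_indep : independent_sigma P
      (sigma_generated [set s : R | 0 <= s] (fun (s : R) (w : T) => N s w))
      (sigma_generated [set: nat] (fun (i : nat) (w : T) => S i w)))
    (t : R) (t_gt0 : 0 < t) :
  let psi : R -> R :=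
    laplace_exponent P (cramer_lundberg 0 p N S) t in
  let psi'0 : R := lim (psi^`()%classic theta @[theta --> 0^'+]) in
  (psi^`()%classic theta @[theta --> 0^'+] --> p - lambda / gamma) /\
  forall x : R, 0 <= x ->
    let tau : T -> \bar R := ruin_time (cramer_lundberg x p N S) in
    let ruin : set T := [set w | (tau w < +oo)%E] in
    [/\ psi'0 < 0 ->
          cond_expectation P ruin tau =
          ((gamma * x + 1) / (lambda - p * gamma))%:E,
        0 < psi'0 ->
          cond_expectation P ruin tau =
          ((lambda / p * x + 1) / (p * gamma - lambda))%:E
      & psi'0 != 0 ->
          cond_variance P ruin tau =
          (2 * lambda * gamma * x / `|p * gamma - lambda| ^+ 3 +
           (p * gamma + lambda) / `|p * gamma - lambda| ^+ 3)%:E].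
Proof.
move=> psi psi'0.
have psi_cvg : psi^`()%classic theta @[theta --> 0^'+] --> p - lambda / gamma.
  exact: (cvg_derive1_laplace_exponent lambda_gt0 gamma_gt0 N_poisson S_law
    S_indep NS_indep t_gt0).
have psi'0E : psi'0 = p - lambda / gamma by exact: cvg_lim psi_cvg.
split => // x x0 tau ruin.
have neg : psi'0 < 0 -> 0 < lambda - p * gamma.
  by rewrite psi'0E subr_lt0 ltr_pdivlMr// subr_gt0.
have pos : 0 < psi'0 -> 0 < p * gamma - lambda.
  by rewrite psi'0E subr_gt0 ltr_pdivrMr// subr_gt0.
have Mneg : psi'0 < 0 ->
    cond_expectation P ruin tau = ((gamma * x + 1) / (lambda - p * gamma))%:E /\
    cond_variance P ruin tau = (2 * lambda * gamma * x / (lambda - p * gamma) ^+ 3 +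
      (p * gamma + lambda) / (lambda - p * gamma) ^+ 3)%:E.
  move=> /neg D0.
  have [||||-> ->] := ruin_cond_moments (R0 := 0) p_gt0 lambda_gt0 gamma_gt0 x0
    N_poisson S_law S_indep NS_indep gamma_gt0 D0 => //; try ring.
  split => //; congr (_%:E).
  by field; rewrite gt_eqF.
have Mpos : 0 < psi'0 ->
    cond_expectation P ruin tau = ((lambda / p * x + 1) / (p * gamma - lambda))%:E /\
    cond_variance P ruin tau = (2 * lambda * gamma * x / (p * gamma - lambda) ^+ 3 +
      (p * gamma + lambda) / (p * gamma - lambda) ^+ 3)%:E.
  move=> /pos D0.
  have g0 : 0 < lambda / p by rewrite divr_gt0.
  have R0 : 0 <= gamma - lambda / p.
    by rewrite subr_ge0 ler_pdivrMr// mulrC -subr_ge0 ltW.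
  have pg : p * (lambda / p) = lambda by field; rewrite gt_eqF.
  have gE : gamma = gamma - lambda / p + lambda / p by rewrite subrK.
  have R0E : (gamma - lambda / p) * (lambda - p * (lambda / p)) = 0.
    by rewrite pg subrr mulr0.
  have DE : p * gamma - lambda = p * (gamma - lambda / p) + lambda - p * (lambda / p).
    by rewrite mulrBr pg; ring.
  have [-> ->] := ruin_cond_moments p_gt0 lambda_gt0 gamma_gt0 x0
    N_poisson S_law S_indep NS_indep g0 D0 R0 gE R0E DE.
  split => //; congr (_%:E).
  by field; rewrite !gt_eqF.
split.
- by move=> /Mneg[].
- by move=> /Mpos[].
(* In both regimes (D + p g) g = lambda gamma and D + 2 p g = p gamma + lambda, so the two variances
   differ only through the sign inside D, which the absolute value absorbs. *)
- rewrite neq_lt => /orP[H|H].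
    have D0 := neg H; have [_ ->] := Mneg H.
    by rewrite distrC gtr0_norm.
  have D0 := pos H; have [_ ->] := Mpos H.
  by rewrite gtr0_norm.
Qed.
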